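(* Let $K$ be a field and let $L$ be a simple planar distributive lattice. Then $\operatorname{reg} R(L)$ equals the maximal number of squares in a cyclic sublattice of $L$.
   Context: For a finite distributive lattice $L$, let $K[L]$ be the polynomial ring over $K$ whose variables are the elements of $L$; $I_L\subset K[L]$ is generated by $ab-(a\vee b)(a\wedge b)$ for all incomparable $a,b\in L$, $R(L)=K[L]/I_L$, and $\operatorname{reg} R(L)$ is its Castelnuovo–Mumford regularity as a graded $K[L]$-module. $\mathbb{N}^2$ is ordered componentwise. A planar distributive lattice is a finite sublattice $L$ of $\mathbb{N}^2$ with $(0,0)\in L$ such that for any $(i,j)\le(k,\ell)$ in $L$ there is a chain $x_0<x_1<\dots<x_t$ in $L$ from $(i,j)$ to $(k,\ell)$ in which the coordinate sum increases by exactly $1$ at each step. A cut edge of a graded lattice is a pair $(a,b)$ with $\operatorname{rank} b=\operatorname{rank} a+1$ such that $a$ is the only element of its rank and $b$ is the only element of its rank; $L$ is simple if it has no cut edge. A square is a sublattice $\{a,b,c,d\}$ with $a\to b\to d$, $a\to c\to d$ (covering relations) and $b,c$ incomparable. A cyclic sublattice is a sublattice consisting of squares $Q_1,\dots,Q_m$ arranged consecutively, the top of $Q_i$ either equal to the bottom of $Q_{i+1}$ or joined to it by a saturated chain of cut edges (of the sublattice). *)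

(* Defs.v *)
From mathcomp Require Import all_boot all_order all_algebra.
From mathcomp Require Import mpoly.
Set Implicit Arguments. Unset Strict Implicit. Unset Printing Implicit Defensive.
Import GRing.Theory.
Local Open Scope ring_scope.

Definition le2 (a b : nat * nat) : bool := ((a.1 <= b.1) && (a.2 <= b.2))%N.
Definition lt2 (a b : nat * nat) : bool := (a != b) && le2 a b.
Definition join2 (a b : nat * nat) : nat * nat := (maxn a.1 b.1, maxn a.2 b.2).
Definition meet2 (a b : nat * nat) : nat * nat := (minn a.1 b.1, minn a.2 b.2).
Definition incomp2 (a b : nat * nat) : bool := ~~ le2 a b && ~~ le2 b a.
Definition csum (a : nat * nat) : nat := (a.1 + a.2)%N.

Definition sublattice2 (L : seq (nat * nat)) : Prop :=
  forall a b, a \in L -> b \in L -> (join2 a b \in L) /\ (meet2 a b \in L).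

Definition unit_step (x y : nat * nat) : bool :=
  lt2 x y && (csum y == (csum x).+1)%N.

Definition planar_distr_lattice (L : seq (nat * nat)) : Prop :=
  [/\ uniq L, sublattice2 L, (0, 0)%N \in L &
   forall a b, a \in L -> b \in L -> le2 a b ->
     exists s : seq (nat * nat),
       [/\ path unit_step a s, last a s = b & all (mem L) s]].

(* In a planar distributive lattice the minimum is (0,0) and every saturated
   chain proceeds by unit steps, so the rank of x is x.1 + x.2 (= csum x). *)
Definition rank2 (x : nat * nat) : nat := csum x.

Definition covers (L : seq (nat * nat)) (a b : nat * nat) : Prop :=
  [/\ a \in L, b \in L, lt2 a b &
   forall c, c \in L -> ~ (lt2 a c /\ lt2 c b)].

Definition only_of_its_rank (S : seq (nat * nat)) (x : nat * nat) : Prop :=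
  forall z, z \in S -> rank2 z = rank2 x -> z = x.

Definition cut_edge (S : seq (nat * nat)) (a b : nat * nat) : Prop :=
  [/\ a \in S, b \in S, rank2 b = (rank2 a).+1,
      only_of_its_rank S a & only_of_its_rank S b].

Definition simple_lattice (L : seq (nat * nat)) : Prop :=
  forall a b, ~ cut_edge L a b.

Definition square (L : seq (nat * nat)) (a b c d : nat * nat) : Prop :=
  [/\ covers L a b /\ covers L b d, covers L a c /\ covers L c d,
      incomp2 b c, join2 b c = d & meet2 b c = a].

Record sq := Sq { sq_a : nat * nat; sq_b : nat * nat;
                  sq_c : nat * nat; sq_d : nat * nat }.

Definition sq_elems (Q : sq) : seq (nat * nat) :=
  [:: sq_a Q; sq_b Q; sq_c Q; sq_d Q].

(* A cyclic sublattice of L with m squares: squares Q_0 .. Q_{m-1} and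
   connecting lists ch_0 .. ch_{m-2}; ch_i lists the elements strictly after
   the top of Q_i up to and including the bottom of Q_{i+1} (empty when the
   top of Q_i equals the bottom of Q_{i+1}).  The chain top(Q_i), ch_i is a
   saturated chain (covering steps of L) all of whose edges are cut edges of
   the sublattice S (= union of all squares and chains); S must be a
   sublattice of L. *)
Definition prop_path (P : nat * nat -> nat * nat -> Prop) (x : nat * nat)
    (s : seq (nat * nat)) : Prop :=
  forall k, (k < size s)%N -> P (nth x (x :: s) k) (nth x (x :: s) k.+1).

Definition cyclic_sublattice (L : seq (nat * nat)) (m : nat) : Prop :=
  exists (Q : nat -> sq) (ch : nat -> seq (nat * nat)),
    let S := flatten [seq sq_elems (Q i) | i <- iota 0 m] ++
             flatten [seq ch i | i <- iota 0 m.-1] in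
    [/\ forall i, (i < m)%N ->
          square L (sq_a (Q i)) (sq_b (Q i)) (sq_c (Q i)) (sq_d (Q i)),
        forall i, (i.+1 < m)%N ->
          [/\ last (sq_d (Q i)) (ch i) = sq_a (Q i.+1),
              prop_path (fun x y => covers L x y /\ cut_edge S x y)
                   (sq_d (Q i)) (ch i) &
              all (mem L) (ch i)],
        all (mem L) S &
        sublattice2 S].

Definition max_cyclic_squares (L : seq (nat * nat)) (m : nat) : Prop :=
  cyclic_sublattice L m /\ forall m', cyclic_sublattice L m' -> (m' <= m)%N.

(* The Hibi ring R(L) = K[L]/I_L; the variable x_i of {mpoly K[size L]}
   corresponds to the element nth (0,0) L i of L.                        *)
Section Hibi.
Variable K : fieldType.
Variable L : seq (nat * nat).
Local Notation S := {mpoly K[size L]}.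

Definition xvar (a : nat * nat) : S :=
  \sum_(i < size L | nth (0, 0)%N L i == a) 'X_i.

Definition hibi_gens : seq S :=
  [seq xvar a * xvar b - xvar (join2 a b) * xvar (meet2 a b)
  | a <- L, b <- [seq b <- L | incomp2 a b]].

Definition in_hibi_ideal (p : S) : Prop :=
  exists c : 'I_(size hibi_gens) -> S,
    p = \sum_(i < size hibi_gens) c i * hibi_gens`_i.
End Hibi.

Definition homog_of_deg (K : fieldType) (n d : nat) (p : {mpoly K[n]}) : bool :=
  all (fun m : 'X_{1..n} => mdeg m == d)%N (msupp p).

(* F_i = (+)_{j < rk i} S(-sh i j);  dm i : F_{i+1} -> F_i, acting on row
   vectors (v |-> v *m dm i). *)
Record gfres (K : fieldType) (n : nat) := GFRes {
  len : nat;
  rk : nat -> nat;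
  sh : forall i, 'I_(rk i) -> nat;
  dm : forall i, 'M[{mpoly K[n]}]_(rk i.+1, rk i) }.
Arguments len {K n} g.
Arguments rk {K n} g i.
Arguments sh {K n} g i j.
Arguments dm {K n} g i.

Definition is_min_graded_free_res (K : fieldType) (n : nat)
    (inI : {mpoly K[n]} -> Prop) (F : gfres K n) : Prop :=
  [/\ rk F 0 = 1%N /\ (forall j, sh F 0 j = 0%N),
      (forall i, (len F < i)%N -> rk F i = 0%N),
      (* the maps are homogeneous of degree 0, and minimal: every nonzero
         entry is homogeneous of positive degree (entries lie in the
         irrelevant maximal ideal) *)
      (forall i j k, dm F i j k != 0 ->
          (sh F i k < sh F i.+1 j)%N /\
          homog_of_deg (sh F i.+1 j - sh F i k) (dm F i j k)),
      (forall v : 'rV_(rk F 0),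
          (exists w, v = w *m dm F 0) <-> (forall j, inI (v 0 j))) &
      (forall i (v : 'rV_(rk F i.+1)),
          v *m dm F i = 0 <-> exists w, v = w *m dm F i.+1)].

Definition reg_of_res (K : fieldType) (n : nat) (F : gfres K n) : nat :=
  \max_(i < (len F).+1) \max_(j < rk F i) (sh F i j - i)%N.

(* reg (S/I) = r : read off from a minimal graded free resolution (the
   graded Betti numbers, hence this value, do not depend on the choice). *)
Definition reg_is (K : fieldType) (n : nat) (inI : {mpoly K[n]} -> Prop)
    (r : nat) : Prop :=
  exists F : gfres K n, is_min_graded_free_res inI F /\ reg_of_res F = r.

(* Main.v *)
From HB Require Import structures.
Require Import Defs.
From mathcomp Require Import all_boot all_order all_algebra.
From mathcomp Require Import mpoly zify.
Set Implicit Arguments. Unset Strict Implicit. Unset Printing Implicit Defensive.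
Import GRing.Theory.
Local Open Scope ring_scope.

(* Let theta_k be the sum of the variables of rank k and T = K[theta].  The
   Hibi ring R is a free T-module: a maximal chain C of L is a lattice path,
   its left turns that can be flipped to the right inside L are its descents,
   and the monomials eta_C, the products of the descents of C, form a T-basis.
   Indeed a standard monomial is in a unique way a product of eta_C with a
   monomial supported on C, and the family of all theta^a eta_C is unitriangular
   with respect to standard monomials.  After a linear change of
   coordinates the theta_k are variables, S = T[y_1, ..., y_c], and the
   variables y_i act on R by commuting T-matrices Y_i, so the Koszul complex of
   the operators y_i - Y_i on the free S-module with basis (eta_C) resolves R.
   Its basis elements of homological degree i have shifts i + #descents(C).
   Cancelling unit entries makes it minimal; the generators with i = c and
   maximal #descents(C) have no neighbour of the same shift and survive.  Hence
   reg R is the maximal number of descents, and the descents of a path are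
   exactly the upper left corners of the squares of a cyclic sublattice. *)

(** * Cancelling unit entries of a resolution *)

(** The ideal is given by generators only, so membership is hard to refute directly. Independence is
    tested through the toric map instead: it kills the ideal and separates standard monomials, and
    nothing more about its kernel is used. The unitriangularity refers to the lexicographic order on
    the pair ([mQ], [mY]), that is, sum of squared ranks, then sum of second coordinates.
    Straightening raises [mQ]; passing from the leading monomial of theta^t eta_C to another
    standard monomial in its expansion keeps [mQ] and raises [mY]. Planarity enters through
    domination: a maximal chain that passes through all descents of C stays weakly to the left of C.
    This yields both the growth of [mY] and the fact that the support of a leading monomial
    determines C. Cancellation is needed because the matrices Y_i may contain nonzero constants, so
    that the Koszul complex over S need not be minimal, while regularity is read off from a minimal
    resolution. *)

Lemma homog_of_degE (K : fieldType) (n d : nat) (p : {mpoly K[n]}) :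
  homog_of_deg d p = (p \is d.-homog).
Proof. by rewrite dhomogE. Qed.

Section Cancellation.
Variables (K : fieldType) (n : nat).
Local Notation S := {mpoly K[n]}.
Variables (E : finType) (hd sh : E -> nat) (aug : E -> S) (I : S -> Prop).
Implicit Types (A : {set E}) (D : E -> E -> S) (v w : E -> S).

(* A complex is encoded by a single matrix [D] on a finite basis [E] with
   homological degrees [hd] and shifts [sh], restricted to an active set [A]
   that shrinks under cancellation; [aug] is the augmentation in degree [0]. *)
Definition supported A v := forall e, e \notin A -> v e = 0.

Definition act D v (f : E) : S := \sum_e v e * D e f.

Definition graded_entries A D := forall e f, D e f != 0 ->
  [/\ e \in A, f \in A, hd e = (hd f).+1, (sh f <= sh e)%N
    & D e f \is (sh e - sh f).-homog].

(** One equivalence covers all homological degrees: when [aug] vanishes in positive degree, the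
    condition on [I] concerns degree 0 only, where it makes the augmentation injective from the
    cokernel to the quotient by [I]. *)
Definition resolves A D := forall v, supported A v ->
  ((forall f, act D v f = 0) /\ I (\sum_e v e * aug e)) <->
  (exists2 w, supported A w & forall f, v f = act D w f).

Definition delta (e x : E) : S := (x == e)%:R.

Lemma act_delta D e f : act D (delta e) f = D e f.
Proof.
rewrite /act (bigD1 e) //= big1 ?addr0 /delta ?eqxx ?mul1r // => i /negPf ->.
by rewrite mul0r.
Qed.

Lemma act_addm D v w s f :
  act D (fun x => v x + s * w x) f = act D v f + s * act D w f.
Proof.
rewrite /act mulr_sumr -big_split; apply: eq_bigr => i _.
by rewrite mulrDl mulrA.
Qed.

Lemma eq_act D v w f : v =1 w -> act D v f = act D w f.
Proof. by move=> vw; apply: eq_bigr => i _; rewrite vw. Qed.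

Lemma resolves_act0 A D w f :
  resolves A D -> graded_entries A D -> supported A w ->
  act D (act D w) f = 0.
Proof.
move=> res gr sw; have sv : supported A (act D w).
  move=> e eA; rewrite /act big1 // => i _.
  by have [->|/gr[_]] := eqVneq (D i e) 0; rewrite ?mulr0 // (negPf eA).
by have [_ /(_ _) []] := res _ sv; first by exists w.
Qed.

(* Gaussian elimination of the unit entry [D e f] against row [e] and column
   [f]. *)
Definition cancelled A D (e f a b : E) : S :=
  if (a \in A :\ e :\ f) && (b \in A :\ e :\ f)
  then D a b - D a f * ((D e f)@_0)^-1%:MP * D e b else 0.

Lemma homog0_const (p : S) : p \is 0.-homog -> p = (p@_0)%:MP.
Proof.
move/dhomogP => hp; apply/mpolyP => m; rewrite mcoeffC.
have [<-|m0] := eqVneq 0%MM m; first by rewrite mulr1.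
rewrite mulr0; apply/memN_msupp_eq0/negP => /hp /eqP.
by rewrite mdeg_eq0 eq_sym (negPf m0).
Qed.

Section Step.
Variables (A : {set E}) (D : E -> E -> S) (e f : E).
Hypotheses (gr : graded_entries A D) (res : resolves A D).
Hypothesis aug0 : forall x, (0 < hd x)%N -> aug x = 0.
Hypotheses (Def : D e f != 0) (she : sh e = sh f).
Let A' := A :\ e :\ f.
(** Equal shifts force [D e f] into degree 0, so it is a constant and [u] is its inverse. *)
Let u : S := ((D e f)@_0)^-1%:MP.
Local Notation D' := (cancelled A D e f).

Let eA : e \in A. Proof. by case: (gr Def). Qed.
Let fA : f \in A. Proof. by case: (gr Def). Qed.
Let hde : hd e = (hd f).+1. Proof. by case: (gr Def). Qed.
Let Du : D e f * u = 1.
Proof.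
have [_ _ _ _] := gr Def; rewrite she subnn => /homog0_const Dc.
move: Def; rewrite /u Dc mcoeffC eqxx mulr1 -mpolyCM => nz.
by rewrite divff ?mpolyC1 //; apply: contraNneq nz => ->; rewrite mpolyC0.
Qed.
Let auge : aug e = 0. Proof. by apply: aug0; rewrite hde. Qed.
Let neqef : e != f.
Proof. by apply/eqP => ef; move: hde; rewrite ef => /eqP; rewrite -[X in X == _]addn0 -addn1 eqn_add2l. Qed.

Let inA' x : (x \in A') = [&& x != f, x != e & x \in A].
Proof. by rewrite /A' !in_setD1. Qed.

Lemma graded_cancelled : graded_entries A' D'.
Proof.
move=> a b; rewrite /cancelled -/A' -/u.
case: ifP => [/andP[aA bA] nz|_]; last by rewrite eqxx.
have grp : D a f * u * D e b != 0 ->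
    [/\ hd a = (hd b).+1, (sh b <= sh a)%N
      & D a f * u * D e b \is (sh a - sh b).-homog].
  move=> nz'; have af : D a f != 0 by apply: contraNneq nz' => ->; rewrite !mul0r.
  have eb : D e b != 0 by apply: contraNneq nz' => ->; rewrite mulr0.
  have [_ _ h1 s1 g1] := gr af; have [_ _ h2 s2 g2] := gr eb.
  split; first by rewrite h1 -hde h2.
    by apply: (leq_trans s2); rewrite she.
  have -> : (sh a - sh b = (sh a - sh f + 0) + (sh e - sh b))%N.
    by rewrite addn0 -she addnBA // subnK // she.
  apply: dhomogM => //; apply: dhomogM => //.
  rewrite /u -alg_mpolyC; apply/rpredZ/dhomog1.
have [D0|/gr[_ _ h s g]] := eqVneq (D a b) 0.
  move: nz; rewrite D0 sub0r oppr_eq0 => /grp[h s g]; split=> //.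
  by rewrite rpredN.
split=> //; have [->|/grp[_ _ g']] := eqVneq (D a f * u * D e b) 0.
  by rewrite subr0.
exact: rpredB.
Qed.

Let actD' v b : supported A' v -> b \in A' ->
  act D' v b = act D v b - act D v f * u * D e b.
Proof.
move=> sv bA; rewrite /act !mulr_suml -sumrB; apply: eq_bigr => a _.
have [aA|/sv ->] := boolP (a \in A'); last by rewrite !mul0r subr0.
by rewrite /cancelled -/A' aA bA /= -/u mulrBr !mulrA.
Qed.

Let actD'0 v b : b \notin A' -> act D' v b = 0.
Proof.
move=> bA; rewrite /act big1 // => a _.
by rewrite /cancelled -/A' (negPf bA) andbF mulr0.
Qed.

Let outA' x : x \in A -> x \notin A' -> x = e \/ x = f.
Proof.
by move=> xA; rewrite inA' xA andbT negb_and !negbK => /orP[]/eqP ->; auto.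
Qed.

Let supA v s t : supported A' v ->
  supported A (fun x => v x + s * delta e x + t * delta f x).
Proof.
move=> sv x xA; rewrite sv ?inA' ?(negPf xA) ?andbF // /delta.
have [xe|_] := eqVneq x e; first by rewrite xe eA in xA.
have [xf|_] := eqVneq x f; first by rewrite xf fA in xA.
by rewrite !mulr0 !addr0.
Qed.

Let sup1 v s : supported A' v -> supported A (fun x => v x + s * delta e x).
Proof.
by move=> sv x /(@supA v s 0 sv); rewrite mul0r addr0.
Qed.

Let aug_e v s : \sum_x (v x + s * delta e x) * aug x = \sum_x v x * aug x.
Proof.
apply: eq_bigr => x _; rewrite mulrDl /delta.
by have [->|_] := eqVneq x e; rewrite ?auge ?mulr0 ?mul0r !addr0.
Qed.

Let actA v b : act D v b != 0 -> b \in A.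
Proof.
apply: contraR => bA; rewrite /act big1 // => a _.
by have [->|/gr[_]] := eqVneq (D a b) 0; rewrite ?mulr0 // (negPf bA).
Qed.

(** Adding to [v] the multiple of [e] that kills the [f]-coordinate of its boundary turns [D'] into
    [D] on [A']. The coordinates at [e] and [f] are then controlled because [D] squares to zero and
    [D e f] is a unit. *)
Lemma resolves_cancelled : resolves A' D'.
Proof.
move=> v sv; pose s := - (act D v f * u).
pose v1 x := v x + s * delta e x.
have sv1 : supported A v1 by apply: sup1.
have act1 b : act D v1 b = act D v b + s * D e b.
  by rewrite /v1 act_addm act_delta.
have act1f : act D v1 f = 0.
  by rewrite act1 /s mulNr -mulrA [u * _]mulrC Du mulr1 subrr.
have act1A b : b \in A' -> act D v1 b = act D' v b.
  by move=> bA; rewrite actD' // act1 /s mulNr.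
split=> [[vD' vI]|[w sw wE]].
(* Only the coordinate of [act D v1] at [e] is still unknown; applying [D] again and reading off [f]
   multiplies it by the unit [D e f]. *)
- have act1e : act D v1 e = 0.
    have /= := resolves_act0 f res gr sv1.
    rewrite (@eq_act D _ (fun x => 0 + act D v1 e * delta e x)); last first.
      move=> x; rewrite add0r /delta; have [->|xe] := eqVneq x e.
        by rewrite mulr1.
      rewrite mulr0; have [->//|xf] := eqVneq x f.
      have [xA|xA] := boolP (x \in A).
        by rewrite act1A ?vD' // inA' xe xf xA.
      by apply/eqP/negP => /negP/actA; rewrite (negPf xA).
    rewrite act_addm act_delta /act big1 ?add0r => [|i _]; last by rewrite mul0r.
    by move/(congr1 ( *%R^~ u)); rewrite -mulrA Du mulr1 mul0r.
  have [ex _] := res sv1; case: ex => [|w sw wE].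
    split=> [x|]; last by rewrite aug_e.
    have [xA|xA] := boolP (x \in A); last first.
      by apply/eqP/negP => /negP/actA; rewrite (negPf xA).
    have [xA'|/(outA' xA)[]->] := boolP (x \in A') => //.
    by rewrite act1A.
  (* [D e] is itself a cycle, so subtracting a multiple of it clears the [f]-coordinate of [w]
     without changing [act D w]. *)
  pose w1 x := w x + (- (w f * u)) * D e x.
  have sw1 : supported A w1.
    move=> x xA; rewrite /w1 sw // add0r.
    have [->|/gr[_ xA']] := eqVneq (D e x) 0; first by rewrite mulr0.
    by rewrite xA' in xA.
  have DD b : act D (D e) b = 0.
    have := resolves_act0 (w := delta e) b res gr.
    rewrite (@eq_act D _ (D e)); last by move=> x; rewrite act_delta.
    by apply=> x xA; rewrite /delta; case: eqP => // xe; rewrite xe eA in xA.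
  have w1E b : v1 b = act D w1 b by rewrite wE /w1 act_addm DD mulr0 addr0.
  have w1f : w1 f = 0.
    by rewrite /w1 mulNr -mulrA [u * _]mulrC Du mulr1 subrr.
  exists (fun x => if x \in A' then w1 x else 0).
    by move=> x /negPf ->.
  set w2 := fun x => _.
  have sw2 : supported A' w2 by move=> x /negPf xA; rewrite /w2 xA.
  have w12 b : act D w1 b = act D w2 b + w1 e * D e b.
    rewrite -(act_delta D) -act_addm; apply: eq_act => x; rewrite /w2 /delta.
    have [xA|xA] := boolP (x \in A').
      have [xe|_] := eqVneq x e; last by rewrite mulr0 addr0.
      by rewrite xe inA' eqxx andbF in xA.
    have [->|xe] := eqVneq x e; first by rewrite mulr1 add0r.
    rewrite mulr0 addr0; have [xA'|xA'] := boolP (x \in A); last by rewrite sw1.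
    have [xxe|->] := outA' xA' xA; last by rewrite w1f.
    by rewrite xxe eqxx in xe.
  have w1eE : w1 e = - (act D w2 f * u).
    have := w1E f; rewrite {1}/v1 sv ?inA' ?eqxx // /delta eq_sym (negPf neqef).
    rewrite mulr0 addr0 w12 => /(congr1 ( *%R^~ u)).
    rewrite mul0r mulrDl -mulrA Du mulr1 addrC => /esym/eqP.
    by rewrite addr_eq0 => /eqP.
  move=> b; have [bA|bA] := boolP (b \in A'); last by rewrite actD'0 // sv.
  rewrite actD' // -mulNr -w1eE -w12 -w1E /v1.
  rewrite /delta; have [be|_] := eqVneq b e; last by rewrite mulr0 addr0.
  by rewrite be inA' eqxx andbF in bA.
- pose t := - (act D w f * u).
  pose w1 x := w x + t * delta e x.
  have sw1 : supported A w1 by apply: sup1.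
  have w1f : act D w1 f = 0.
    by rewrite act_addm act_delta mulNr -mulrA [u * _]mulrC Du mulr1 subrr.
  have w1A b : b \in A' -> act D w1 b = v b.
    by move=> bA; rewrite wE actD' // act_addm act_delta /t mulNr.
  (* [act D w1] is [v] plus [x] times the basis vector [e]; being a cycle, it forces [x] to be the
     correction [s]. *)
  pose x := act D w1 e.
  have w1E : act D w1 =1 (fun b => v b + x * delta e b).
    move=> b; rewrite /delta; have [->|be] := eqVneq b e.
      by rewrite mulr1 sv ?add0r // inA' eqxx andbF.
    rewrite mulr0 addr0; have [bA|bA] := boolP (b \in A'); first by rewrite w1A.
    rewrite sv //; have [bA'|bA'] := boolP (b \in A).
      by have [bbe|->] := outA' bA' bA; rewrite ?w1f // bbe eqxx in be.
    by apply/eqP/negP => /negP/actA; rewrite (negPf bA').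
  have vx b : act D v b + x * D e b = 0.
    have := resolves_act0 b res gr sw1.
    by rewrite (eq_act _ _ w1E) act_addm act_delta.
  have xE : x = - (act D v f * u).
    have /(congr1 ( *%R^~ u)) := vx f; rewrite mulrDl mul0r -mulrA Du mulr1 addrC.
    by move/eqP; rewrite addr_eq0 => /eqP.
  split=> [b|].
    have [bA|bA] := boolP (b \in A'); last by rewrite actD'0.
    by rewrite actD' // -mulNr -xE vx.
  have [_ im] := res (@sup1 _ x sv).
  by have [|_] := im; [exists w1 => // b; rewrite w1E | rewrite aug_e].
Qed.

End Step.

(* Cancellations only remove pairs of equal shift in adjacent homological
   degrees, so protected elements survive all of them. *)
Definition protected A (g : E) := g \in A /\ forall e, e \in A ->
  (hd e = (hd g).+1 \/ hd g = (hd e).+1) -> sh e <> sh g.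

Definition minimal_entries D := forall e f, D e f != 0 -> (sh f < sh e)%N.

Lemma exists_minimal A D :
  (forall x, (0 < hd x)%N -> aug x = 0) -> graded_entries A D -> resolves A D ->
  exists A' D', [/\ A' \subset A, graded_entries A' D', resolves A' D',
    minimal_entries D' & forall g, protected A g -> g \in A'].
Proof.
move=> aug0; have [k] := ubnP #|A|; elim: k A D => // k IH A D Ak gr res.
have [/forallP mi|] := boolP [forall x, forall y, (D x y != 0) ==> (sh x != sh y)].
  exists A, D; split=> // [e f nz|g []//].
  have [_ _ _ le _] := gr _ _ nz.
  by rewrite ltn_neqAle le andbT eq_sym; move: (mi e) => /forallP/(_ f)/implyP; apply.
rewrite negb_forall => /existsP[e]; rewrite negb_forall => /existsP[f].
rewrite negb_imply negbK => /andP[nz /eqP she].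
have [eA fA hde _ _] := gr _ _ nz.
have [|A' [D' [sA gr' res' mi pr]]] := IH (A :\ e :\ f) (cancelled A D e f) _
  (graded_cancelled gr nz she) (resolves_cancelled gr res aug0 nz she).
  apply: (@leq_trans #|A|); last by rewrite -ltnS.
  by rewrite (cardsD1 e A) eA ltnS subset_leq_card ?subsetDl.
exists A', D'; split=> //.
  by apply: subset_trans sA _; apply: subset_trans (subsetDl _ _) (subsetDl _ _).
move=> g [gA gP]; apply: pr; split.
  rewrite !in_setD1 gA andbT; apply/andP; split; apply/eqP => ge.
    by apply: (gP e eA); [left; rewrite ge | rewrite ge].
  by apply: (gP f fA); [right; rewrite ge | rewrite ge].
by move=> x; rewrite !in_setD1 => /andP[_ /andP[_ /gP]].
Qed.

End Cancellation.

(** * From one matrix to a sequence of free modules *)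

Section ToGfres.
Variables (K : fieldType) (n : nat).
Local Notation S := {mpoly K[n]}.
Variables (E : finType) (hd sh : E -> nat) (aug : E -> S) (I : S -> Prop).
Variables (A : {set E}) (D : E -> E -> S).
Hypotheses (gr : graded_entries hd sh A D) (res : resolves aug I A D).
Hypothesis mi : minimal_entries sh D.

Definition level (i : nat) := [set e in A | hd e == i].
Definition lev (i : nat) (j : 'I_#|level i|) : E := enum_val j.
Definition embed (i : nat) (v : 'rV[S]_#|level i|) (e : E) : S :=
  \sum_j v 0 j * @delta K n E (lev j) e.
Definition restrict (i : nat) (v : E -> S) : 'rV[S]_#|level i| := \row_j v (lev j).

Lemma levP i (j : 'I_#|level i|) : lev j \in A /\ hd (lev j) = i.
Proof. by have := enum_valP j; rewrite inE => /andP[? /eqP]. Qed.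

Lemma lev_surj i e : e \in A -> hd e = i -> exists j : 'I_#|level i|, lev j = e.
Proof.
move=> eA /eqP he; have ei : e \in level i by rewrite inE eA he.
by exists (enum_rank_in ei e); rewrite /lev enum_rankK_in.
Qed.

Lemma embed_lev i (v : 'rV_#|level i|) j : embed v (lev j) = v 0 j.
Proof.
rewrite /embed (bigD1 j) //= big1 ?addr0 /delta ?eqxx ?mulr1 // => k kj.
rewrite eq_sym (inj_eq enum_val_inj); by rewrite (negPf kj) mulr0.
Qed.

Lemma embed_out i (v : 'rV_#|level i|) e : e \notin level i -> embed v e = 0.
Proof.
move=> ei; rewrite /embed big1 // => k _; rewrite /delta.
have [ek|_] := eqVneq e (lev k); last by rewrite mulr0.
by rewrite ek enum_valP in ei.
Qed.

Lemma embedP i (v : 'rV_#|level i|) e :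
  (exists2 j, e = lev j & embed v e = v 0 j) \/
  (e \notin level i /\ embed v e = 0).
Proof.
have [ei|ei] := boolP (e \in level i); last by right; rewrite embed_out.
move: ei; rewrite inE => /andP[eA /eqP he].
by have [j <-] := lev_surj eA he; left; exists j; rewrite ?embed_lev.
Qed.

Lemma embed_supported i (v : 'rV_#|level i|) : supported A (embed v).
Proof. by move=> e eA; rewrite embed_out // inE negb_and eA. Qed.

Lemma sum_embed i (v : 'rV_#|level i|) (F : E -> S) :
  \sum_e embed v e * F e = \sum_j v 0 j * F (lev j).
Proof.
rewrite /embed; under eq_bigr => e _ do rewrite mulr_suml.
rewrite exchange_big; apply: eq_bigr => j _ /=.
rewrite (bigD1 (lev j)) //= big1 ?addr0 /delta ?eqxx ?mulr1 // => e /negPf ->.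
by rewrite mulr0 mul0r.
Qed.

Lemma D_hd e f : hd e <> (hd f).+1 -> D e f = 0.
Proof. by move=> h; apply/eqP/negP => /negP/gr[]. Qed.

Lemma D_in e f : (e \notin A) || (f \notin A) -> D e f = 0.
Proof.
by move=> h; apply/eqP/negP => /negP/gr[eA fA]; rewrite eA fA in h.
Qed.

Lemma act_embed_restrict i w f :
  f \in level i -> act D (embed (restrict i.+1 w)) f = act D w f.
Proof.
rewrite inE => /andP[fA /eqP fi]; apply: eq_bigr => e _.
have [[j -> ->]|[ei ->]] := embedP (restrict i.+1 w) e; first by rewrite mxE.
rewrite mul0r; have [eA|eA] := boolP (e \in A); last by rewrite D_in ?eA ?mulr0.
rewrite D_hd ?mulr0 // fi => he.
by move: ei; rewrite inE eA he eqxx.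
Qed.

Lemma act_embed_out i (v : 'rV_#|level i.+1|) f :
  f \notin level i -> act D (embed v) f = 0.
Proof.
move=> fi; rewrite /act big1 // => e _.
have [[j -> _]|[_ ->]] := embedP v e; last by rewrite mul0r.
have [fA|fA] := boolP (f \in A); last by rewrite D_in ?fA ?orbT ?mulr0.
rewrite D_hd ?mulr0 // (proj2 (levP j)) => -[fE].
by move: fi; rewrite inE fA fE eqxx.
Qed.

Definition gfres_of (c : nat) : gfres K n :=
  @GFRes K n c (fun i => #|level i|) (fun i j => sh (lev j))
    (fun i => \matrix_(j, k) D (lev j) (lev k)).

Lemma mulmx_dm c i (v : 'rV_#|level i.+1|) (k : 'I_#|level i|) :
  (v *m dm (gfres_of c) i) 0 k = act D (embed v) (lev k).
Proof.
by rewrite mxE /act sum_embed; apply: eq_bigr => j _; rewrite mxE.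
Qed.

Variables (c m : nat) (b0 : E).
Hypotheses (hdc : forall e, e \in A -> (hd e <= c)%N) (b0A : b0 \in A).
Hypotheses (hb0 : hd b0 = 0%N) (sb0 : sh b0 = 0%N) (ab0 : aug b0 = 1).
Hypothesis b0_uniq : forall e, e \in A -> hd e = 0%N -> e = b0.
Hypothesis aug0 : forall x, (0 < hd x)%N -> aug x = 0.
Hypothesis I0 : I 0.

Lemma level0 : level 0 = [set b0].
Proof.
apply/setP => e; rewrite !inE; apply/andP/eqP => [[eA /eqP]|->].
  exact: b0_uniq.
by rewrite b0A hb0 eqxx.
Qed.

Lemma lev0 (j : 'I_#|level 0|) : lev j = b0.
Proof. by have [jA jh] := levP j; apply: b0_uniq. Qed.

Lemma gfres_of_min : is_min_graded_free_res I (gfres_of c).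
Proof.
split => /=.
- by split=> [|j]; rewrite ?level0 ?cards1 ?lev0.
- move=> i ci; apply/eqP; rewrite cards_eq0; apply/eqP/setP => e.
  rewrite !inE; apply/negP => /andP[/hdc + /eqP he].
  by rewrite he leqNgt ci.
- move=> i j k; rewrite mxE => nz; split; first exact: mi.
  by rewrite homog_of_degE; have [] := gr nz.
- move=> v; have exv (j : 'I_#|level 0|) : \sum_e embed v e * aug e = v 0 j.
    rewrite sum_embed (bigD1 j) //= big1 ?lev0 ?ab0 ?mulr1 ?addr0 // => k kj.
    case/eqP: kj; apply: enum_val_inj.
    by rewrite -/(lev k) -/(lev j) !lev0.
  have v0 f : act D (embed v) f = 0.
    rewrite /act big1 // => e _.
    have [[j -> _]|[_ ->]] := embedP v e; last by rewrite mul0r.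
    by rewrite D_hd ?mulr0 // lev0 hb0.
  have [exI Iex] := res (embed_supported v).
  split=> [[w vE] j|vI].
    have [|_] := Iex; last by rewrite (exv j).
    exists (embed w); first exact: embed_supported.
    move=> f; have [[k -> ->]|[fi ->]] := embedP v f; last by rewrite act_embed_out.
    by rewrite -(mulmx_dm c) -vE.
  have [j _] := lev_surj b0A hb0.
  have [|w sw wE] := exI; first by split=> //; rewrite (exv j).
  exists (restrict 1 w); apply/rowP => k.
  by rewrite (mulmx_dm c) (act_embed_restrict (i := 0) w) ?enum_valP -?wE ?embed_lev.
move=> i v; have [exI Iex] := res (embed_supported v).
split=> [v0|[w vE]].
  have [|w sw wE] := exI.
    split=> [f|]; last first.
      rewrite sum_embed big1 // => j _; rewrite aug0 ?mulr0 //.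
      by rewrite (proj2 (levP j)).
    have [fi|fi] := boolP (f \in level i); last by rewrite act_embed_out.
    have /andP[fA /eqP fh] : (f \in A) && (hd f == i) by rewrite inE in fi.
    by have [k <-] := lev_surj fA fh; rewrite -(mulmx_dm c) v0 mxE.
  exists (restrict i.+2 w); apply/rowP => k.
  by rewrite (mulmx_dm c) (act_embed_restrict (i := i.+1) w) ?enum_valP -?wE ?embed_lev.
have [|vD _] := Iex; last by apply/rowP => k; rewrite (mulmx_dm c) vD mxE.
exists (embed w); first exact: embed_supported.
move=> f; have [[k -> ->]|[fi ->]] := embedP v f; last by rewrite act_embed_out.
by rewrite -(mulmx_dm c) -vE.
Qed.

Lemma reg_gfres_of :
  (forall e, e \in A -> (sh e - hd e <= m)%N) ->
  (exists2 g, g \in A & (sh g - hd g)%N = m) ->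
  reg_of_res (gfres_of c) = m.
Proof.
move=> ub [g gA gm]; apply/eqP; rewrite eqn_leq; apply/andP; split.
  apply/bigmax_leqP => i _; apply/bigmax_leqP => j _ /=.
  by have [jA jh] := levP j; have := ub _ jA; rewrite jh.
have gc : (hd g < c.+1)%N by rewrite ltnS hdc.
have [j jg] := lev_surj gA (erefl (hd g)).
apply: (@leq_trans (\max_(k < rk (gfres_of c) (hd g)) (sh (lev k) - hd g))%N).
  by rewrite -gm -{1}jg; apply: (leq_bigmax j).
exact: (leq_bigmax (Ordinal gc)).
Qed.

End ToGfres.

(** * Koszul complexes of commuting operators *)

Section Koszul.
Variables (R : comNzRingType) (N : lmodType R) (n : nat) (Y : {set 'I_n}).
Variable psi : 'I_n -> {linear N -> N}.
Hypothesis psiC : forall i j x, psi i (psi j x) = psi j (psi i x).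
Implicit Types (J : {set 'I_n}) (v w : {set 'I_n} -> N) (i j : 'I_n) (k : nat).

Definition ksign i J : R := (-1) ^+ #|[set j in J | (j < i)%N]|.

(** The Koszul differential in coordinates: [v J] is the coefficient of the exterior monomial on
    [J]. The cut-off [k] keeps only the operators of index below [k], so that they can be added one
    at a time. *)
Definition kdiff k v J : N :=
  \sum_(i : 'I_n | [&& (i < k)%N, i \in Y & i \notin J]) ksign i J *: psi i (v (i |: J)).

Definition kimage k (x : N) :=
  exists z : 'I_n -> N, x = \sum_(i : 'I_n | (i < k)%N && (i \in Y)) psi i (z i).

Definition ksupported k v :=
  forall J, ~~ (J \subset [set i in Y | (i < k)%N]) -> v J = 0.

Lemma ksign0 i : ksign i set0 = 1.
Proof.
rewrite /ksign (_ : [set j in _ | _] = set0) ?cards0 //.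
by apply/setP => j; rewrite !inE.
Qed.

Lemma ksignU_ge i j J : (i <= j)%N -> ksign i (j |: J) = ksign i J.
Proof.
move=> ij; congr (_ ^+ #|pred_of_set _|); apply/setP => x; rewrite !inE.
by have [->|] := eqVneq x j; rewrite //= ltnNge ij andbF.
Qed.

Lemma ksignU_lt i j J : (j < i)%N -> j \notin J -> ksign i (j |: J) = - ksign i J.
Proof.
move=> ji jJ; rewrite /ksign (_ : [set x in j |: J | _] =
    j |: [set x in J | (x < i)%N]).
  by rewrite cardsU1 !inE (negPf jJ) exprS mulN1r.
by apply/setP => x; rewrite !inE; have [->|] := eqVneq x j; rewrite //= ji.
Qed.

Lemma kdiffS (kk : 'I_n) v J : kdiff kk.+1 v J =
  kdiff kk v J +
  (if (kk \in Y) && (kk \notin J) then ksign kk J *: psi kk (v (kk |: J)) else 0).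
Proof.
rewrite /kdiff; case: ifP => [kY|kY].
  rewrite (bigD1 kk) /=; last by rewrite ltnSn.
  rewrite addrC; congr (_ + _); apply: eq_bigl => i.
  by rewrite ltnS ltn_neqAle -(inj_eq val_inj) [LHS]andbC -!andbA.
rewrite addr0; apply: eq_bigl => i; rewrite ltnS leq_eqVlt.
have [/val_inj ->|] //= := eqVneq (i : nat) kk.
by rewrite kY ltnn.
Qed.

Lemma kdiff_lt_in (kk : 'I_n) v J :
  kk \in J -> kdiff kk.+1 v J = kdiff kk v J.
Proof. by move=> kJ; rewrite kdiffS kJ andbF addr0. Qed.

Lemma eq_kdiff k v w J :
  (forall i, i \notin J -> (i < k)%N -> v (i |: J) = w (i |: J)) ->
  kdiff k v J = kdiff k w J.
Proof. by move=> vw; apply: eq_bigr => i /and3P[ik _ iJ]; rewrite vw. Qed.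

(** When [kk] is added, only the two mixed terms are new. They cancel: inserting a smaller index
    flips the sign attached to [kk], whereas inserting [kk] leaves the sign of the smaller index
    alone. *)
Lemma kdiffK k v J : (k <= n)%N -> kdiff k (kdiff k v) J = 0.
Proof.
elim: k v J => [|k IH] v J kn; first by rewrite /kdiff big1.
have [kk kE] : exists kk : 'I_n, k = kk :> nat by exists (Ordinal kn).
subst k.
pose e w (H : {set 'I_n}) : N := if (kk \in Y) && (kk \notin H)
  then ksign kk H *: psi kk (w (kk |: H)) else 0.
have dE w H : kdiff kk.+1 w H = kdiff kk w H + e w H by rewrite kdiffS.
rewrite dE; have -> : kdiff kk (kdiff kk.+1 v) J = kdiff kk (e v) J.
  rewrite -[RHS]add0r -[in RHS](IH v J) 1?ltnW // /kdiff -big_split /=.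
  apply: eq_bigr => i _; rewrite -scalerDr -linearD; congr (_ *: psi i _).
  exact: dE.
rewrite /e; have [kY|kY] := boolP (kk \in Y); last first.
  rewrite /kdiff big1 ?addr0 // => i _.
  by rewrite linear0 scaler0.
have [kJ|kJ] := boolP (kk \in J).
  rewrite /kdiff big1 ?addr0 // => i _ /=.
  by rewrite in_setU1 kJ orbT linear0 scaler0.
rewrite /= kdiff_lt_in ?setU11 // /kdiff linear_sum scaler_sumr.
have predE i : [&& (i < kk)%N, i \in Y & i \notin kk |: J] =
    [&& (i < kk)%N, i \in Y & i \notin J].
  rewrite in_setU1; have [->|//] := eqVneq i kk; by rewrite ltnn.
rewrite [X in _ + X](eq_bigl _ _ predE) -big_split.
apply: big1 => i /and3P[ik iY iJ].
have ki : kk != i by apply: contraTneq ik => <-; rewrite ltnn.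
rewrite /= in_setU1 (negPf ki) (negPf kJ) /=.
rewrite !linearZ /= !scalerA (psiC kk) (ksignU_lt ik) // (ksignU_ge _ (ltnW ik)).
by rewrite mulNr scaleNr setUCA mulrC addNr.
Qed.

Hypothesis psi_reg : forall (k : 'I_n) x,
  k \in Y -> kimage k (psi k x) -> kimage k x.

Lemma kimageB k x y : kimage k x -> kimage k y -> kimage k (x - y).
Proof.
move=> [z ->] [t ->]; exists (fun i => z i - t i).
by rewrite -sumrB; apply: eq_bigr => i _; rewrite linearB.
Qed.

Lemma kimage0 k : kimage k 0.
Proof. by exists (fun=> 0); rewrite big1 // => i _; rewrite linear0. Qed.

Lemma kimageN k x : kimage k x -> kimage k (- x).
Proof. by move=> kx; rewrite -sub0r; apply: kimageB => //; apply: kimage0. Qed.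

Lemma kimage_kdiff k v : kimage k (kdiff k v set0).
Proof.
exists (fun i => v (i |: set0)); apply: eq_big => [i|i _].
  by rewrite inE andbT.
by rewrite ksign0 scale1r.
Qed.

Lemma kimageS (kk : 'I_n) x : kk \in Y -> kimage kk.+1 x ->
  exists z, kimage kk (x - psi kk z).
Proof.
move=> kY [z ->]; exists (z kk), z.
rewrite (bigD1 kk) ?ltnSn //= addrAC subrr add0r; apply: eq_bigl => i.
by rewrite ltnS ltn_neqAle -(inj_eq val_inj) [LHS]andbC -!andbA.
Qed.

(* Passing from [k] to [k.+1] is a mapping cone along [psi k], which is
   injective modulo the images of its predecessors. *)
Lemma kdiff_exact k v : (k <= n)%N ->
  ksupported k v -> (forall J, kdiff k v J = 0) -> kimage k (v set0) ->
  exists2 w, ksupported k w & forall J, v J = kdiff k w J.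
Proof.
elim: k v => [|k IH] v kn sv dv v0.
  exists (fun=> 0) => // J; rewrite /kdiff big1 //.
  have [->|J0] := eqVneq J set0.
    by have [z ->] := v0; rewrite big1.
  apply: sv; apply: contra J0 => /subsetP sJ.
  by apply/eqP/setP => x; rewrite inE; apply/negP => /sJ; rewrite inE andbF.
have [kk kE] : exists kk : 'I_n, k = kk :> nat by exists (Ordinal kn).
subst k; have kn' : (kk <= n)%N by rewrite ltnW.
have [kY|kY] := boolP (kk \in Y); last first.
  have dE w J : kdiff kk.+1 w J = kdiff kk w J.
    by rewrite kdiffS (negPf kY) addr0.
  have sE w : ksupported kk.+1 w <-> ksupported kk w.
    suff e : [set i in Y | (i < kk.+1)%N] = [set i in Y | (i < kk)%N].
      by rewrite /ksupported e.
    apply/setP => i; rewrite !inE ltnS leq_eqVlt.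
    have [/val_inj ->|] //= := eqVneq (i : nat) kk.
    by rewrite (negPf kY).
  have [|||w sw wE] := IH v kn'.
  - by apply/sE.
  - by move=> J; rewrite -dE.
  - have [z ->] := v0; exists z; apply: eq_bigl => i; rewrite ltnS leq_eqVlt.
    have [/val_inj ->|] //= := eqVneq (i : nat) kk.
    by rewrite (negPf kY) andbF.
  by exists w => [|J]; [apply/sE | rewrite dE].
have subS J : kk \notin J -> J \subset [set i in Y | (i < kk)%N] =
    (J \subset [set i in Y | (i < kk.+1)%N]).
  move=> kJ; apply/subsetP/subsetP => sJ x xJ; have := sJ x xJ; rewrite !inE.
    by rewrite ltnS => /andP[-> /ltnW].
  rewrite ltnS leq_eqVlt => /andP[-> /orP[/eqP/val_inj xk|->]] //.
  by rewrite xk (negPf kJ) in xJ.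
have subU J : kk \notin J -> J \subset [set i in Y | (i < kk)%N] =
    (kk |: J \subset [set i in Y | (i < kk.+1)%N]).
  by move=> kJ; rewrite subS // subUset sub1set inE kY ltnSn.
have neq i : (i < kk)%N -> kk == i = false.
  by move=> ik; apply/negP => /eqP ki; rewrite -ki ltnn in ik.
(* The part of [v] along the new index [kk]. The cycle condition at sets containing [kk] makes it a
   cycle of the smaller complex, and the one at [set0] together with [psi_reg] puts [v2 set0] in the
   image. *)
pose v2 (J : {set 'I_n}) := if kk \in J then 0 else v (kk |: J).
have sv2 : ksupported kk v2.
  move=> J sJ; rewrite /v2; case: ifPn => // kJ.
  by apply: sv; rewrite -subU.
have dv2 J : kdiff kk v2 J = 0.
  have [kJ|kJ] := boolP (kk \in J).
    rewrite /kdiff big1 // => i _.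
    by rewrite /v2 in_setU1 kJ orbT linear0 scaler0.
  rewrite -(dv (kk |: J)) kdiff_lt_in ?setU11 //; apply: eq_big => [i|i].
    rewrite in_setU1 [i == kk]eq_sym; have [ik|] //= := boolP (i < kk)%N.
    by rewrite neq.
  case/and3P=> ik iY iJ.
  rewrite /v2 in_setU1 neq // (negPf kJ) /= (ksignU_ge _ (ltnW ik)).
  by rewrite setUCA.
have v20 : kimage kk (v2 set0).
  apply: psi_reg => //; have := dv set0; rewrite kdiffS kY !inE /=.
  rewrite ksign0 scale1r addrC => /eqP; rewrite addr_eq0 => /eqP.
  rewrite /v2 inE => ->; apply/kimageN/kimage_kdiff.
have [w2 sw2 w2E] := IH _ kn' sv2 dv2 v20.
have [z zE] := kimageS kY v0.
(* The differential never reads the coordinate at [set0], so [w2] may be replaced there by [z],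
   chosen to bring [u set0] below into the image of the earlier operators. *)
pose w3 (J : {set 'I_n}) := if J == set0 then z else w2 J.
have sw3 : ksupported kk w3.
  move=> J sJ; rewrite /w3; case: eqP sJ => [->|_ /sw2 //].
  by rewrite sub0set.
have w3E J : v2 J = kdiff kk w3 J.
  rewrite w2E; apply: eq_kdiff => i _ _; rewrite /w3; case: eqP => // e.
  by have := setU11 i J; rewrite e inE.
pose u (J : {set 'I_n}) := if kk \in J then 0 else v J - ksign kk J *: psi kk (w3 J).
have su : ksupported kk u.
  move=> J sJ; rewrite /u; case: ifPn => // kJ.
  by rewrite (sw3 J sJ) linear0 scaler0 subr0 sv // -subS.
have du J : kdiff kk u J = 0.
  have [kJ|kJ] := boolP (kk \in J).
    rewrite /kdiff big1 // => i _.
    by rewrite /u in_setU1 kJ orbT linear0 scaler0.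
  have := dv J; rewrite kdiffS kY kJ /=.
  have -> : v (kk |: J) = v2 J by rewrite /v2 (negPf kJ).
  rewrite w3E /kdiff linear_sum scaler_sumr -big_split /= => dvJ.
  rewrite -[RHS]dvJ; apply: eq_bigr => i /and3P[ik iY iJ].
  rewrite /u in_setU1 neq // (negPf kJ) /= linearB scalerBr; congr (_ + _).
  rewrite !linearZ /= (ksignU_lt ik) // (psiC kk) scalerN.
  by rewrite scaleNr opprK.
have u0 : kimage kk (u set0).
  by rewrite /u inE ksign0 scale1r /w3 eqxx.
have [w1 sw1 w1E] := IH _ kn' su du u0.
(* The preimage has [w3] as its part along [kk] and [w1] as the rest. *)
exists (fun J => if kk \in J then w3 (J :\ kk) else w1 J).
  move=> J sJ; case: ifPn => kJ.
    by apply: sw3; rewrite subU ?setD1K // !inE eqxx.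
  by apply: sw1; rewrite subS.
move=> J; have [kJ|kJ] := boolP (kk \in J).
  rewrite kdiff_lt_in //; transitivity (v2 (J :\ kk)).
    by rewrite /v2 !inE eqxx setD1K.
  rewrite w3E; apply: eq_big => [i|i].
    rewrite !inE [i == kk]eq_sym; have [ik|] //= := boolP (i < kk)%N.
    by rewrite neq.
  case/and3P=> ik iY iJ; rewrite in_setU1 kJ orbT.
  have -> : (i |: J) :\ kk = i |: (J :\ kk).
    apply/setP => x; rewrite !inE; have [->|//] := eqVneq x i.
    by rewrite eq_sym neq.
  by rewrite -[in ksign i J](setD1K kJ) (ksignU_ge _ (ltnW ik)).
rewrite kdiffS kY kJ /= setU11 setU1K //.
rewrite (@eq_kdiff _ _ w1); last first.
  by move=> i iJ ik; rewrite in_setU1 neq // (negPf kJ).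
by rewrite -w1E /u (negPf kJ) subrK.
Qed.

End Koszul.

(** * Modules that are free over a polynomial subring *)

Lemma mpoly_ring_ind (K : fieldType) (n : nat) (P : {mpoly K[n]} -> Prop) :
  (forall c, P c%:MP) -> (forall i, P 'X_i) ->
  (forall p q, P p -> P q -> P (p + q)) ->
  (forall p q, P p -> P q -> P (p * q)) -> forall p, P p.
Proof.
move=> PC PX PD PM; elim/mpolyind => [|c m p _ _ Pp]; first by rewrite -mpolyC0.
apply: PD => //; rewrite -mul_mpolyC; apply: (PM) => //; rewrite mpolyXE_id.
have P1 : P 1 by rewrite -mpolyC1.
apply: (big_ind P P1 PM) => i _; elim: (m i) => [|e IH]; first by rewrite expr0.
by rewrite exprS; apply: PM.
Qed.

Section VariableFree.
Variables (K : fieldType) (n : nat) (Y : {set 'I_n}).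
Local Notation S := {mpoly K[n]}.

(** Membership in the polynomial ring on the variables outside [Y], kept as a predicate on [S] to
    avoid a second ring. *)
Definition free_of (p : S) :=
  forall m, m \in msupp p -> forall i, i \in Y -> m i = 0%N.

Lemma free_of0 : free_of 0. Proof. by move=> m; rewrite msupp0. Qed.

Lemma free_ofD p q : free_of p -> free_of q -> free_of (p + q).
Proof. by move=> fp fq m /msuppD_le; rewrite mem_cat => /orP[/fp|/fq]. Qed.

Lemma free_ofN p : free_of p -> free_of (- p).
Proof. by move=> fp m; rewrite (perm_mem (msuppN p)) => /fp. Qed.

Lemma free_ofM p q : free_of p -> free_of q -> free_of (p * q).
Proof.
move=> fp fq m /msuppM_le/allpairsP[[m1 m2] /= [/fp h1 /fq h2 ->]] i iY.
by rewrite mnmDE h1 ?h2.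
Qed.

Lemma free_ofC c : free_of c%:MP.
Proof.
by move=> m; rewrite msuppC; case: eqP => //= _; rewrite inE => /eqP -> i _; rewrite mnm0E.
Qed.

Lemma free_ofX i : i \notin Y -> free_of 'X_i.
Proof.
move=> iY m; rewrite msuppX inE => /eqP -> j jY; rewrite mnm1E.
by case: eqP => // ij; rewrite ij jY in iY.
Qed.

Lemma free_of_sum (T : finType) (P : pred T) (F : T -> S) :
  (forall x, P x -> free_of (F x)) -> free_of (\sum_(x | P x) F x).
Proof. by move=> fF; elim/big_ind: _ => //; [apply: free_of0 | apply: free_ofD]. Qed.

Definition expand (k : 'I_n) : S -> {poly S} :=
  mmap (polyC \o @mpolyC n K) (fun i => if i == k then 'X else ('X_i)%:P).

Lemma expandB k p q : expand k (p - q) = expand k p - expand k q.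
Proof. exact: rmorphB. Qed.

Lemma expandM k p q : expand k (p * q) = expand k p * expand k q.
Proof. exact: rmorphM. Qed.

Lemma expandX k i : expand k 'X_i = if i == k then 'X else ('X_i)%:P.
Proof. by rewrite /expand mmapX mmap1U. Qed.

Lemma expand_free k p : k \in Y -> free_of p -> expand k p = p%:P.
Proof.
move=> kY fp; rewrite [in RHS](mpolyE p) rmorph_sum /= /expand /mmap.
apply: eq_big_seq => m mp; rewrite -mul_mpolyC polyCM; congr (_ * _).
rewrite /mmap1 (mpolyXE_id _ m) rmorph_prod; apply: eq_bigr => i _ /=.
have [->|_] := eqVneq i k; last by rewrite rmorphXn.
by rewrite (fp _ mp) // !expr0.
Qed.

Lemma expandK k p : (expand k p).['X_k] = p.
Proof.
rewrite [in RHS](mpolyE p) /expand /mmap horner_sum; apply: eq_bigr => m _.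
rewrite hornerM /= hornerC -mul_mpolyC; congr (_ * _).
rewrite /mmap1 (mpolyXE_id _ m) horner_prod; apply: eq_bigr => i _.
by rewrite horner_exp; case: eqP => [->|]; rewrite ?hornerX ?hornerC.
Qed.

(* The coefficient of ['X_k ^+ e], as a polynomial in the other variables; it
   is sealed because failing unifications would otherwise unfold [mmap]. *)
Fact vcoef_key : unit. Proof. exact: tt. Qed.
Definition vcoef k e : S -> S := locked_with vcoef_key (fun p => (expand k p)`_e).

Lemma vcoefE k e p : vcoef k e p = (expand k p)`_e.
Proof. by rewrite /vcoef unlock. Qed.

Lemma vcoefB k e p q : vcoef k e (p - q) = vcoef k e p - vcoef k e q.
Proof. by rewrite !vcoefE expandB coefB. Qed.

Lemma vcoef_sum k e (T : finType) (P : pred T) (F : T -> S) :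
  vcoef k e (\sum_(x | P x) F x) = \sum_(x | P x) vcoef k e (F x).
Proof.
have v0 : vcoef k e 0 = 0 by have := vcoefB k e 0 0; rewrite !subrr.
have vD p q : vcoef k e (p + q) = vcoef k e p + vcoef k e q.
  by rewrite -{1}[q]opprK vcoefB -[- q]sub0r vcoefB v0 sub0r opprK.
exact: (big_morph (vcoef k e) vD v0).
Qed.

Lemma vcoef_mulr k e p q : k \in Y -> free_of q ->
  vcoef k e (p * q) = vcoef k e p * q.
Proof. by move=> kY fq; rewrite !vcoefE expandM (expand_free kY fq) coefMC. Qed.

Lemma vcoefXM k e i p : i != k -> vcoef k e ('X_i * p) = 'X_i * vcoef k e p.
Proof. by move=> /negPf ik; rewrite !vcoefE expandM expandX ik coefCM. Qed.

Lemma vcoefXMS k e p : vcoef k e.+1 ('X_k * p) = vcoef k e p.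
Proof. by rewrite !vcoefE expandM expandX eqxx coefXM. Qed.

Lemma vcoef_large k e p : (size (expand k p) <= e)%N -> vcoef k e p = 0.
Proof. by move=> se; rewrite vcoefE nth_default. Qed.

Lemma vcoefK k M p : (size (expand k p) <= M)%N ->
  p = \sum_(e < M) 'X_k ^+ e * vcoef k e p.
Proof.
move=> sM; rewrite -[LHS](expandK k) (horner_coef_wide _ sM).
by apply: eq_bigr => e _; rewrite vcoefE mulrC.
Qed.

End VariableFree.

(** * Multiplication tables over the subring free of [Y] *)

Section FreeBasis.
Variables (K : fieldType) (n : nat) (Y : {set 'I_n}).
Local Notation S := {mpoly K[n]}.
Variables (r : nat) (eta : 'I_r -> S) (dg : 'I_r -> nat) (I : S -> Prop).
Hypotheses (I0 : I 0) (ID : forall p q, I p -> I q -> I (p + q)).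
Hypothesis IM : forall p q : S, I q -> I (p * q).
Hypothesis eta_indep : forall t : 'I_r -> S,
  (forall b, free_of Y (t b)) -> I (\sum_b t b * eta b) -> forall b, t b = 0.
Local Notation N := 'rV[S]_r.
Implicit Types (i j k : 'I_n) (b c d : 'I_r) (v w : N).

Lemma IB p q : I p -> I q -> I (p - q).
Proof. by move=> Ip Iq; rewrite -mulN1r; apply/ID/IM. Qed.

Lemma I_sum (T : finType) (P : pred T) (F : T -> S) :
  (forall x, P x -> I (F x)) -> I (\sum_(x | P x) F x).
Proof. by move=> IF; elim/big_ind: _. Qed.

Variable t : 'I_n -> 'M[S]_r.
Hypothesis t_free : forall i b c, free_of Y (t i b c).
Hypothesis tI : forall i b, I ('X_i * eta b - \sum_c t i b c * eta c).

Fact psi_key : unit. Proof. exact: tt. Qed.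
Definition psi i := locked_with psi_key (fun v => 'X_i *: v - v *m t i : N).

Lemma psiE i v : psi i v = 'X_i *: v - v *m t i.
Proof. by rewrite /psi unlock. Qed.

Lemma psi_is_linear i : linear (psi i).
Proof.
move=> a u v; rewrite !psiE mulmxDl -scalemxAl !scalerDr scalerN opprD !scalerA.
by rewrite ['X_i * a]mulrC addrACA.
Qed.
HB.instance Definition _ i := GRing.isLinear.Build S N N *:%R (psi i) (psi_is_linear i).

Definition psi_lin i : {linear N -> N} := psi i.

(** Both products describe multiplication by ['X_i * 'X_j] modulo [I]; their difference is a
    relation among the [eta] with coefficients free of [Y], hence zero. *)
Lemma t_comm i j : t i *m t j = t j *m t i.
Proof.
apply/matrixP => b d; apply/eqP; rewrite -subr_eq0; apply/eqP.
move: d; apply: eta_indep => [d|].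
  rewrite !mxE; apply: free_ofD; last apply: free_ofN;
  by apply: free_of_sum => c _; apply: free_ofM; apply: t_free.
have XX i' j' : I ('X_j' * 'X_i' * eta b - \sum_d (t i' *m t j') b d * eta d).
  have -> : 'X_j' * 'X_i' * eta b - \sum_d (t i' *m t j') b d * eta d =
      'X_j' * ('X_i' * eta b - \sum_c t i' b c * eta c) +
      \sum_c t i' b c * ('X_j' * eta c - \sum_d t j' c d * eta d).
    under [X in _ = _ + X]eq_bigr => c _ do rewrite mulrBr mulrCA mulr_sumr.
    rewrite sumrB -mulr_sumr addrA -mulrDr subrK mulrA; congr (_ - _).
    rewrite exchange_big; apply: eq_bigr => d _ /=.
    by rewrite mxE mulr_suml; apply: eq_bigr => c _; rewrite mulrA.
  by apply: ID; [apply: IM | apply: I_sum => c _; apply: IM].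
have -> : \sum_d ((t i *m t j) b d - (t j *m t i) b d) * eta d =
    ('X_i * 'X_j * eta b - \sum_d (t j *m t i) b d * eta d) -
    ('X_j * 'X_i * eta b - \sum_d (t i *m t j) b d * eta d).
  rewrite ['X_j * _]mulrC opprB addrC addrA subrK -sumrB.
  by apply: eq_bigr => d _; rewrite mulrBl.
by apply: IB.
Qed.

Lemma psi_mulC i j v : psi i (v *m t j) = psi i v *m t j.
Proof. by rewrite !psiE mulmxBl -scalemxAl -!mulmxA t_comm. Qed.

Lemma psiC i j v : psi i (psi j v) = psi j (psi i v).
Proof. by rewrite (psiE j v) (psiE j) linearB linearZ /= psi_mulC. Qed.

Local Notation kimage := (kimage Y psi_lin).

Lemma kimageD m v w : kimage m v -> kimage m w -> kimage m (v + w).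
Proof. by move=> kv kw; rewrite -[w]opprK; apply/kimageB/kimageN. Qed.

Lemma kimageZ m a v : kimage m v -> kimage m (a *: v).
Proof.
move=> [z ->]; exists (fun i => a *: z i); rewrite scaler_sumr.
by apply: eq_bigr => i _; rewrite linearZ.
Qed.

Lemma kimage_sum m (T : finType) (F : T -> N) :
  (forall x, kimage m (F x)) -> kimage m (\sum_x F x).
Proof.
by move=> kF; elim/big_ind: _ => //; [apply: kimage0 | apply: kimageD].
Qed.

Lemma kimage_mul m i v : kimage m v -> kimage m (v *m t i).
Proof.
move=> [z ->]; exists (fun j => z j *m t i); rewrite mulmx_suml.
by apply: eq_bigr => j _; rewrite [LHS]/= -psi_mulC.
Qed.

Definition coef_row k e v : N := map_mx (vcoef k e) v.

Lemma coef_row_mul k e i v : k \in Y -> coef_row k e (v *m t i) = coef_row k e v *m t i.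
Proof.
move=> kY; apply/rowP => c; rewrite !mxE vcoef_sum.
apply: eq_bigr => b _; rewrite mxE.
by rewrite (vcoef_mulr _ _ kY) //; apply: t_free.
Qed.

Lemma coef_row_psi k e i v : k \in Y -> i != k ->
  coef_row k e (psi i v) = psi i (coef_row k e v).
Proof.
move=> kY ik; rewrite !psiE -coef_row_mul //; apply/rowP => c.
by rewrite !mxE vcoefB vcoefXM.
Qed.

Lemma coef_row_psiS k e v : k \in Y ->
  coef_row k e v = coef_row k e.+1 (psi k v) + coef_row k e.+1 v *m t k.
Proof.
move=> kY; rewrite -coef_row_mul //; apply/rowP => c.
by rewrite psiE !mxE vcoefB vcoefXMS subrK.
Qed.

Lemma coef_row_sum k e (P : pred 'I_n) (F : 'I_n -> N) :
  coef_row k e (\sum_(i | P i) F i) = \sum_(i | P i) coef_row k e (F i).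
Proof.
apply/rowP => c; rewrite mxE !summxE vcoef_sum.
by apply: eq_bigr => i _; rewrite mxE.
Qed.

(* Comparing coefficients of ['X_k ^+ e.+1] expresses the coefficient of degree
   [e] of [v] through that of degree [e.+1], modulo the image: descend from the
   top degree. *)
Lemma psi_reg k v : k \in Y -> kimage k (psi_lin k v) -> kimage k v.
Proof.
move=> kY [z zE]; pose M := (\max_b size (expand k (v ord0 b)))%N.
have big e : (M <= e)%N -> coef_row k e v = 0.
  move=> Me; apply/rowP => b; rewrite !mxE vcoef_large //.
  by apply: leq_trans Me; rewrite /M (bigD1 b) //=; exact: leq_maxl.
have im e : kimage k (coef_row k e v).
  have [f] := ubnP (M - e)%N; elim: f e => // f IH e Me.
  have [/big ->|eM] := leqP M e; first exact: kimage0.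
  rewrite coef_row_psiS //; apply: kimageD; last first.
    apply/kimage_mul/IH; by rewrite subnS -ltnS prednK ?subn_gt0.
  exists (fun i => coef_row k e.+1 (z i)); rewrite zE coef_row_sum.
  apply: eq_bigr => i /andP[ik _]; rewrite [LHS]/= coef_row_psi //.
  by apply: contraTneq ik => ->; rewrite ltnn.
have -> : v = \sum_(e < M) 'X_k ^+ e *: coef_row k e v.
  apply/rowP => b; rewrite summxE [LHS](@vcoefK _ _ k M).
    by apply: eq_bigr => e _; rewrite !mxE.
  rewrite /M (bigD1 b) //=; exact: leq_maxl.
by apply: kimage_sum => e; apply: kimageZ.
Qed.

Definition eps v : S := \sum_b v 0 b * eta b.

Lemma eps_kimage m v : kimage m v -> I (eps v).
Proof.
move=> [z ->]; have -> : eps (\sum_(i : 'I_n | (i < m)%N && (i \in Y)) psi_lin i (z i)) =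
    \sum_(i : 'I_n | (i < m)%N && (i \in Y)) eps (psi_lin i (z i)).
  rewrite /eps exchange_big; apply: eq_bigr => b _ /=.
  by rewrite summxE mulr_suml.
apply: I_sum => i _; have -> : eps (psi_lin i (z i)) =
    \sum_b z i 0 b * ('X_i * eta b - \sum_c t i b c * eta c).
  under [RHS]eq_bigr => b _ do rewrite mulrBr mulr_sumr.
  rewrite sumrB exchange_big -sumrB; apply: eq_bigr => b _.
  rewrite [psi_lin i _]/= psiE !mxE mulrBl; congr (_ - _); first by rewrite mulrCA mulrA.
  by rewrite mulr_suml; apply: eq_bigr => c _; rewrite mulrA.
by apply: I_sum => b _; apply: IM.
Qed.

Lemma kimage_psi i v : i \in Y -> kimage n (psi_lin i v).
Proof.
move=> iY; exists (fun j => if j == i then v else 0).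
rewrite (bigD1 i) ?ltn_ord ?iY //= eqxx big1 ?addr0 // => j /andP[_ /negPf ->].
by rewrite linear0.
Qed.

(** Modulo the image of [psi i] with [i \in Y], multiplying by ['X_i] amounts to applying [t i],
    whose entries are free of [Y]. Ring induction on the scalars thus removes all variables of
    [Y]. *)
Lemma reduce_free v :
  exists2 w : N, (forall b, free_of Y (w 0 b)) & kimage n (v - w).
Proof.
pose P (p : S) := forall w : N, (forall b, free_of Y (w 0 b)) ->
  exists2 w' : N, (forall b, free_of Y (w' 0 b)) & kimage n (p *: w - w').
have PC (a : K) : P a%:MP.
  move=> w fw; exists (a%:MP *: w); last by rewrite subrr; apply: kimage0.
  by move=> b; rewrite mxE; apply: free_ofM; [apply: free_ofC | apply: fw].
have PD p q : P p -> P q -> P (p + q).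
  move=> Pp Pq w fw; have [w1 f1 k1] := Pp w fw; have [w2 f2 k2] := Pq w fw.
  exists (w1 + w2); first by move=> b; rewrite mxE; apply: free_ofD; [apply: f1|apply: f2].
  by rewrite scalerDl opprD addrACA; apply: kimageD.
have PM p q : P p -> P q -> P (p * q).
  move=> Pp Pq w fw; have [w1 f1 k1] := Pq w fw; have [w2 f2 k2] := Pp w1 f1.
  exists w2 => //; rewrite -scalerA.
  have -> : p *: (q *: w) - w2 = p *: (q *: w - w1) + (p *: w1 - w2).
    by rewrite scalerBr addrA subrK.
  by apply: kimageD => //; apply: kimageZ.
have PX i : P 'X_i.
  move=> w fw; have [iY|iY] := boolP (i \in Y).
    exists (w *m t i); last by rewrite -psiE; apply: kimage_psi.
    move=> b; rewrite mxE; apply: free_of_sum => c _.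
    by apply: free_ofM; [apply: fw | apply: t_free].
  exists ('X_i *: w); last by rewrite subrr; apply: kimage0.
  by move=> b; rewrite mxE; apply: free_ofM; [apply: free_ofX | apply: fw].
have PA := mpoly_ring_ind PC PX PD PM.
have fe b c : free_of Y ((delta_mx 0 b : N) 0 c).
  by rewrite mxE -mpolyC_nat; apply: free_ofC.
have /fin_all_exists2[w fw kw] b := PA (v 0 b) (delta_mx 0 b) (fe b).
exists (\sum_b w b) => [b|].
  by rewrite summxE; apply: free_of_sum => c _; apply: fw.
have -> : v - \sum_b w b = \sum_b (v 0 b *: delta_mx 0 b - w b).
  by rewrite sumrB -row_sum_delta.
exact: kimage_sum.
Qed.

(** After [reduce_free] the vector is free of [Y], and [eta_indep] leaves only 0. *)
Lemma kimage_eps v : I (eps v) -> kimage n v.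
Proof.
move=> Iv; have [w fw kw] := reduce_free v.
suff w0 : w = 0 by rewrite w0 subr0 in kw.
apply/rowP => b; rewrite mxE; move: b; apply: eta_indep => //.
have -> : \sum_b w 0 b * eta b = eps v - eps (v - w).
  rewrite /eps -sumrB; apply: eq_bigr => b _.
  by rewrite !mxE -mulrBl subKr.
by apply: IB => //; apply: eps_kimage kw.
Qed.

End FreeBasis.

(** * The Koszul resolution of a quotient that is free over that subring *)

Section Resolution.
Variables (K : fieldType) (n : nat) (Y : {set 'I_n}).
Local Notation S := {mpoly K[n]}.
Variables (r : nat) (eta : 'I_r -> S) (dg : 'I_r -> nat) (I : S -> Prop).
Hypotheses (I0 : I 0) (ID : forall p q, I p -> I q -> I (p + q)).
Hypothesis IM : forall p q : S, I q -> I (p * q).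
Hypothesis eta_indep : forall t : 'I_r -> S,
  (forall b, free_of Y (t b)) -> I (\sum_b t b * eta b) -> forall b, t b = 0.
Variable t : 'I_n -> 'M[S]_r.
Hypothesis t_free : forall i b c, free_of Y (t i b c).
Hypothesis t_homog : forall i b c, t i b c != 0 ->
  (dg c <= (dg b).+1)%N /\ t i b c \is ((dg b).+1 - dg c).-homog.
Hypothesis tI : forall i b, I ('X_i * eta b - \sum_c t i b c * eta c).
Variable b0 : 'I_r.
Hypotheses (eta_b0 : eta b0 = 1) (dg_b0 : dg b0 = 0%N).

Local Notation E := ({set 'I_n} * 'I_r)%type.
Definition khd (e : E) : nat := #|e.1|.
Definition ksh (e : E) : nat := (#|e.1| + dg e.2)%N.
Definition kaug (e : E) : S := if e.1 == set0 then eta e.2 else 0.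
Definition kact : {set E} := [set e : E | e.1 \subset Y].

Definition kterm (i : 'I_n) (b c : 'I_r) : S := 'X_i *+ (b == c) - t i b c.

(** At most one [i] contributes, the element of [e.1] outside [f.1]; the sum merely names it. The
    row [e] is the source, as in [act]. *)
Definition kmat (e f : E) : S := if e.1 \subset Y then
  \sum_(i | [&& i \in Y, i \notin f.1 & e.1 == i |: f.1])
    ksign S i f.1 * kterm i e.2 f.2 else 0.

Definition vrow (v : E -> S) (J : {set 'I_n}) : 'rV[S]_r := \row_b v (J, b).

Lemma kterm_homog i b c : kterm i b c != 0 ->
  (dg c <= (dg b).+1)%N /\ kterm i b c \is ((dg b).+1 - dg c).-homog.
Proof.
rewrite /kterm; have [->|bc] := eqVneq b c => /=; last first.
  by rewrite mulr0n sub0r oppr_eq0 dhomogN => /t_homog.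
move=> _; split=> //; rewrite mulr1n subSnn; apply: rpredB.
  by rewrite dhomogX /= mdeg1.
have [->|/t_homog[_]] := eqVneq (t i c c) 0; first exact: rpred0.
by rewrite subSnn.
Qed.

Lemma kmat_graded : graded_entries khd ksh kact kmat.
Proof.
move=> [H b] [J c]; rewrite /kmat /khd /ksh /kact /=.
case: ifP => [HY nz|_]; last by rewrite eqxx.
have [i /and3P[iY iJ /eqP HE] knz] : exists2 i,
    [&& i \in Y, i \notin J & H == i |: J] & kterm i b c != 0.
  apply/exists_inP; apply: contraNT nz; rewrite negb_exists => /forallP h.
  rewrite big1 // => i ci; have := h i; rewrite ci /= negbK => /eqP ->.
  by rewrite mulr0.
have cH : #|H| = #|J|.+1 by rewrite HE cardsU1 iJ.
have [le _] := kterm_homog knz.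
split; rewrite ?inE //=.
- by apply: subset_trans HY; rewrite HE subsetUr.
- by rewrite cH addSnnS leq_add2l.
rewrite cH addSnnS subnDl; apply: rpred_sum => j _.
have [->|/kterm_homog[_ hk]] := eqVneq (kterm j b c) 0.
  by rewrite mulr0 rpred0.
by rewrite /ksign -signr_odd mulr_sign; case: ifP => _; rewrite ?rpredN.
Qed.

Lemma act_kmat v J c : supported kact v ->
  act kmat v (J, c) = kdiff Y (psi_lin t) n (vrow v) J 0 c.
Proof.
move=> sv; rewrite /act /kdiff summxE.
transitivity (\sum_H \sum_b v (H, b) * kmat (H, b) (J, c)).
  by rewrite pair_bigA; apply: eq_bigr => -[].
transitivity (\sum_H \sum_(i | [&& i \in Y, i \notin J & H == i |: J])
    \sum_b v (H, b) * (ksign S i J * kterm i b c)).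
  apply: eq_bigr => H _; rewrite exchange_big; apply: eq_bigr => b _ /=.
  rewrite /kmat /=; case: ifPn => HY; first by rewrite mulr_sumr.
  by rewrite sv ?inE // mul0r big1 // => i _; rewrite mul0r.
rewrite (exchange_big_dep (fun i : 'I_n => (i \in Y) && (i \notin J))) /=; last first.
  by move=> H i _ /and3P[-> ->].
apply: eq_big => [i|i /andP[iY iJ]]; first by rewrite ltn_ord.
rewrite (big_pred1 (i |: J)) => [|H]; last by rewrite /= iY iJ.
rewrite mxE [psi_lin t i _]/= psiE !mxE mulrBr mulr_sumr.
transitivity (\sum_b (ksign S i J * (v (i |: J, b) * ('X_i *+ (b == c)))
   - ksign S i J * (vrow v (i |: J) 0 b * t i b c))).
  by apply: eq_bigr => b _; rewrite mxE -mulrBr -mulrBr mulrCA.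
rewrite sumrB (bigD1 c) //= big1 ?addr0 ?eqxx => [|b /negPf ->]; last first.
  by rewrite mulr0n !mulr0.
by rewrite mulr1n [v _ * _]mulrC.
Qed.

Lemma sum_kaug v : \sum_e v e * kaug e = eps eta (vrow v set0).
Proof.
rewrite /eps; transitivity (\sum_H \sum_b v (H, b) * kaug (H, b)).
  by rewrite pair_bigA; apply: eq_bigr => -[].
rewrite (bigD1 set0) //= [X in _ + X]big1 ?addr0 => [|H /negPf H0]; last first.
  by rewrite big1 // => b _; rewrite /kaug H0 mulr0.
by apply: eq_bigr => b _; rewrite /kaug eqxx mxE.
Qed.

Lemma Yset : [set i in Y | (i < n)%N] = Y.
Proof. by apply/setP => i; rewrite inE ltn_ord andbT. Qed.

Lemma kmat_resolves : resolves kaug I kact kmat.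
Proof.
move=> v sv; have tC := psiC I0 ID IM eta_indep t_free tI.
have sV : ksupported Y n (vrow v).
  by move=> J; rewrite Yset => JY; apply/rowP => b; rewrite !mxE sv ?inE.
split=> [[dv ev]|[w sw wE]].
- have rg := psi_reg I0 ID IM eta_indep t_free tI.
  have [J||w sw wE] := kdiff_exact tC rg (leqnn n) sV.
  + by apply/rowP => c; rewrite -act_kmat // dv mxE.
  + apply: (kimage_eps I0 ID IM eta_indep t_free tI).
    by rewrite -sum_kaug.
  have ws : supported kact (fun e => w e.1 0 e.2).
    by move=> [J b]; rewrite inE /= => JY; rewrite sw ?Yset // mxE.
  exists (fun e => w e.1 0 e.2) => // -[J c].
  have eqw : kdiff Y (psi_lin t) n w J =
      kdiff Y (psi_lin t) n (vrow (fun e => w e.1 0 e.2)) J.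
    by apply: eq_kdiff => i _ _; apply/rowP => b; rewrite mxE.
  by rewrite (act_kmat J c ws) -eqw -(wE J) mxE.
have vE J : vrow v J = kdiff Y (psi_lin t) n (vrow w) J.
  by apply/rowP => c; rewrite -act_kmat // -wE mxE.
split=> [[J c]|].
  have eqv : kdiff Y (psi_lin t) n (vrow v) J =
      kdiff Y (psi_lin t) n (kdiff Y (psi_lin t) n (vrow w)) J.
    by apply: eq_kdiff => i _ _; apply: vE.
  by rewrite (act_kmat J c sv) eqv (kdiffK Y tC _ J (leqnn n)) mxE.
rewrite sum_kaug vE; apply: (eps_kimage I0 ID IM tI (m := n)).
exact: kimage_kdiff.
Qed.

Lemma free_basis_resolution_tables : exists F : gfres K n,
  is_min_graded_free_res I F /\ reg_of_res F = (\max_b dg b)%N.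
Proof.
have kaug0 e : (0 < khd e)%N -> kaug e = 0.
  by rewrite /khd card_gt0 /kaug => /negPf ->.
have [A [D [sA gr res mi pr]]] := exists_minimal kaug0 kmat_graded kmat_resolves.
(* A shift is at least the homological degree, so no generator of degree 1 has shift 0 and this one
   is protected. *)
have b0A : (set0, b0) \in A.
  apply: pr; split=> [|[H b]]; first by rewrite inE sub0set.
  rewrite /khd /ksh /= cards0 dg_b0 => _ [] // -> //.
have hdc e : e \in A -> (khd e <= #|Y|)%N.
  by move=> /(subsetP sA); rewrite inE; apply: subset_leq_card.
(* Another generator [e] of degree 0 would make [e - eta e.2 * b0] a cycle with augmentation 0,
   hence a boundary. Its coordinate at [e] is 1, but the entries of a minimal differential have no
   constant term. *)
have uniq0 e : e \in A -> khd e = 0%N -> e = (set0, b0).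
  move=> eA he; apply/eqP; apply/negP => /negP eb0.
  have e1 : e.1 = set0 by apply/eqP; rewrite -cards_eq0 -/(khd e) he.
  pose v x := delta K n e x + (- eta e.2) * delta K n (set0, b0) x.
  have sv : supported A v.
    move=> x xA; rewrite /v /delta; case: eqP xA => [->|_]; first by rewrite eA.
    by case: eqP => [->|_]; rewrite ?b0A // mulr0 addr0.
  have D0 g f : khd g = 0%N -> D g f = 0.
    by move=> hg; apply/eqP/negP => /negP/gr[_ _]; rewrite hg.
  have [exI _] := res v sv; have [|w sw wE] := exI.
    split=> [f|]; first by rewrite act_addm !act_delta !D0 ?mulr0 ?addr0 // /khd cards0.
    rewrite -[X in I X]/(act (fun x _ => kaug x) v e) act_addm !act_delta.
    by rewrite /kaug e1 eqxx eta_b0 mulr1 subrr.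
  have /(congr1 (mcoeff 0%MM)) := wE e.
  rewrite /v /delta eqxx (negPf eb0) mulr0 addr0 -mpolyC1 mcoeffC eqxx mulr1.
  rewrite raddf_sum big1 => [/eqP|x _]; first by rewrite oner_eq0.
  rewrite /= (mcoeff0_is_multiplicative _ _).1; have [->|nz] := eqVneq (D x e) 0.
    by rewrite mcoeff0 mulr0.
  have [_ _ _ _ hx] := gr _ _ nz.
  rewrite (dhomog_nemf_coeff hx) ?mulr0 //= mdeg0 eq_sym subn_eq0 -ltnNge.
  exact: mi.
exists (gfres_of khd ksh A D #|Y|); split.
  by apply: (gfres_of_min gr res mi hdc b0A); rewrite /khd /ksh /kaug /= ?cards0 ?eqxx.
have bmax b : (dg b <= \max_b dg b)%N by exact: leq_bigmax.
have [bm bmE] : {bm | \max_b dg b = dg bm}%N.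
  by apply: eq_bigmax; rewrite card_ord (leq_ltn_trans _ (ltn_ord b0)).
apply: (reg_gfres_of _ hdc) => [e _|]; first by rewrite /ksh /khd addKn.
(* This generator survives: [#|Y|] is the top homological degree, and a generator of degree
   [#|Y| - 1] with the same shift would need a [dg] one above the maximum. *)
exists (Y, bm); last by rewrite /ksh /khd addKn bmE.
apply: pr; split=> [|[H b]]; first by rewrite inE subxx.
rewrite inE /khd /ksh /= => HY [hH|-> /eqP].
  by have := subset_leq_card HY; rewrite hH ltnn.
rewrite addSnnS eqn_add2l => /eqP bE; have := bmax b.
by rewrite bE bmE ltnn.
Qed.

End Resolution.

Lemma free_basis_resolution (K : fieldType) (n : nat) (Y : {set 'I_n}) (r : nat)
    (eta : 'I_r -> {mpoly K[n]}) (dg : 'I_r -> nat) (I : {mpoly K[n]} -> Prop)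
    (b0 : 'I_r) :
  I 0 -> (forall p q, I p -> I q -> I (p + q)) ->
  (forall p q, I q -> I (p * q)) ->
  (forall b, eta b \is (dg b).-homog) ->
  (forall k p, p \is k.-homog -> exists t : 'I_r -> {mpoly K[n]},
    [/\ forall b, free_of Y (t b),
        forall b, t b != 0 -> (dg b <= k)%N /\ t b \is (k - dg b).-homog
      & I (p - \sum_b t b * eta b)]) ->
  (forall t : 'I_r -> {mpoly K[n]}, (forall b, free_of Y (t b)) ->
    I (\sum_b t b * eta b) -> forall b, t b = 0) ->
  eta b0 = 1 -> dg b0 = 0%N ->
  exists F : gfres K n,
    is_min_graded_free_res I F /\ reg_of_res F = (\max_b dg b)%N.
Proof.
move=> I0 ID IM eh gen ind e0 d0.
have hX i b : 'X_i * eta b \is (dg b).+1.-homog.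
  by rewrite -add1n; apply: dhomogM => //; rewrite dhomogX /= mdeg1.
have /fin_all_exists[t tP] (i : 'I_n) : exists t : 'I_r -> 'I_r -> {mpoly K[n]},
    forall b, [/\ forall c, free_of Y (t b c),
      forall c, t b c != 0 ->
        (dg c <= (dg b).+1)%N /\ t b c \is ((dg b).+1 - dg c).-homog
      & I ('X_i * eta b - \sum_c t b c * eta c)].
  by have [t tP] := fin_all_exists (fun b => gen _ _ (hX i b)); exists t.
apply: (@free_basis_resolution_tables _ _ Y _ eta dg I I0 ID IM ind
  (fun i => \matrix_(b, c) t i b c) _ _ _ b0) => // [i b c|i b c|i b].
- by rewrite mxE; have [fr _ _] := tP i b; apply: fr.
- by rewrite mxE; have [_ hom _] := tP i b; apply: hom.
have [_ _] := tP i b; congr (I (_ - _)).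
by apply: eq_bigr => c _; rewrite mxE.
Qed.

(** * Linear changes of coordinates *)

Section Transport.
Variables (K : fieldType) (n : nat).
Local Notation S := {mpoly K[n]}.
Variables (f g : {rmorphism S -> S}) (I : S -> Prop).
Hypotheses (fK : cancel f g) (gK : cancel g f).
Hypothesis f_homog : forall d p, p \is d.-homog -> f p \is d.-homog.

Definition map_gfres (F : gfres K n) : gfres K n :=
  @GFRes K n (len F) (rk F) (@sh K n F) (fun i => map_mx f (dm F i)).

(** A graded automorphism applied to the matrix entries keeps degrees, and its inverse carries
    solutions of the linear systems back. *)
Lemma map_gfres_min F :
  is_min_graded_free_res (fun p => I (f p)) F ->
  is_min_graded_free_res I (map_gfres F).
Proof.
have fKm a b (A : 'M[S]_(a, b)) : map_mx g (map_mx f A) = A.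
  by apply/matrixP => i j; rewrite !mxE fK.
have gKm a b (A : 'M[S]_(a, b)) : map_mx f (map_mx g A) = A.
  by apply/matrixP => i j; rewrite !mxE gK.
case=> F0 Flen Fgr Fim Fex; split=> //=.
- move=> i j k; rewrite mxE => nz; have [|lt ho] := Fgr i j k.
    by apply: contraNneq nz => ->; rewrite rmorph0.
  by split=> //; rewrite homog_of_degE f_homog // -homog_of_degE.
- move=> v; have [im1 im2] := Fim (map_mx g v); split=> [[w vE] j|Iv].
    have := im1 _ j; rewrite mxE gK; apply.
    by exists (map_mx g w); rewrite vE map_mxM fKm.
  have [|w wE] := im2; first by move=> j; rewrite mxE gK.
  by exists (map_mx f w); rewrite -map_mxM -wE gKm.
move=> i v; have [ex1 ex2] := Fex i (map_mx g v); split=> [v0|[w vE]].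
  have [|w wE] := ex1; last by exists (map_mx f w); rewrite -map_mxM -wE gKm.
  by rewrite -[LHS]fKm map_mxM gKm v0 map_mx0.
rewrite -[v]gKm -map_mxM ex2 ?map_mx0 //.
by exists (map_mx g w); rewrite vE map_mxM fKm.
Qed.

Lemma reg_map_gfres F : reg_of_res (map_gfres F) = reg_of_res F.
Proof. by []. Qed.

End Transport.

Section Substitution.
Variables (K : fieldType) (n : nat).
Local Notation S := {mpoly K[n]}.

Definition subst (l : 'I_n -> S) : S -> S := mmap (@mpolyC n K) l.

HB.instance Definition _ l := GRing.RMorphism.on (subst l).

Lemma substX l i : subst l 'X_i = l i.
Proof. by rewrite /subst mmapX mmap1U. Qed.

Lemma substC l c : subst l c%:MP = c%:MP.
Proof. exact: mmapC. Qed.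

Lemma subst_homog l d p : (forall i, l i \is 1.-homog) ->
  p \is d.-homog -> subst l p \is d.-homog.
Proof.
move=> hl /dhomogP hp; rewrite /subst /mmap big_seq; apply: rpred_sum => m mp.
rewrite mul_mpolyC rpredZ // -(hp m mp) /= mdegE /mmap1.
elim/big_rec2: _ => [|i d' q _ hq]; first exact: dhomog1.
by apply: dhomogM => //; have := dhomogMn (m i) (hl i); rewrite mul1n.
Qed.

Lemma substK l l' : (forall i, subst l (l' i) = 'X_i) ->
  cancel (subst l') (subst l).
Proof.
move=> ll'; elim/mpoly_ring_ind => [c|i|p q Ip Iq|p q Ip Iq].
- by rewrite !substC.
- by rewrite substX.
- by rewrite !rmorphD /= Ip Iq.
- by rewrite !rmorphM /= Ip Iq.
Qed.

End Substitution.

(** * Lattice paths and their descents *)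

Section PlanarChains.
Variable L : seq (nat * nat).
Hypothesis PL : planar_distr_lattice L.
Local Notation n := (size L).
Implicit Types (i j x y z p q : 'I_n) (C D : {set 'I_n}).

Definition pt i : nat * nat := nth (0, 0)%N L i.
Definition ptrk i : nat := csum (pt i).

Lemma pt_in i : pt i \in L. Proof. exact: mem_nth. Qed.

Lemma pt_inj : injective pt.
Proof.
case: PL => uL _ _ _ i j /eqP; rewrite nth_uniq // => /eqP; exact: val_inj.
Qed.

Lemma ptP a : a \in L -> exists i, pt i = a.
Proof.
move=> aL; have lt : (index a L < n)%N by rewrite index_mem.
by exists (Ordinal lt); rewrite /pt nth_index.
Qed.

Lemma ptrk_inj i j : ptrk i = ptrk j -> (pt i).2 = (pt j).2 -> i = j.
Proof.
rewrite /ptrk /csum => e1 e2; apply: pt_inj; move: e1; rewrite e2.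
by move/addIn; case: (pt i) (pt j) e2 => [a b] [c d] /= -> ->.
Qed.

Lemma pt_interp a b k : a \in L -> b \in L -> le2 a b ->
  (csum a <= k <= csum b)%N -> exists z, [/\ ptrk z = k, le2 a (pt z) & le2 (pt z) b].
Proof.
case: PL => _ _ _ conn aL bL ab; have [s [ps <- sL]] := conn _ _ aL bL ab.
elim: s a aL ps sL {ab bL b} => [|c s IH] a aL /=.
  move=> _ _; rewrite -eqn_leq => /eqP ak; have [z za] := ptP aL.
  by exists z; rewrite /ptrk za ak /le2 !leqnn.
case/andP=> /andP[/andP[_ ac] /eqP rc] ps /andP[cL sL] /andP[ak kb].
have last_ge : le2 c (last c s).
  elim: s c ps {IH ac rc cL sL kb} => [|d s IH] c /=; first by rewrite /le2 !leqnn.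
  case/andP=> /andP[/andP[_ /andP[cd1 cd2]] _] /IH /andP[h1 h2].
  by rewrite /le2 (leq_trans cd1) ?(leq_trans cd2).
have [ck|kc] := leqP (csum c) k.
  have [z [zk cz zl]] := IH c cL ps sL (introT andP (conj ck kb)).
  exists z; split=> //; move: ac cz => /andP[h1 h2] /andP[h3 h4].
  by rewrite /le2 (leq_trans h1) ?(leq_trans h2).
have [z za] := ptP aL; exists z; rewrite /ptrk za /le2 !leqnn; split=> //.
  by apply/eqP; rewrite eqn_leq ak -ltnS -rc kc.
move: ac last_ge => /andP[h1 h2] /andP[h3 h4].
by rewrite (leq_trans h1) ?(leq_trans h2).
Qed.

Lemma pt_origin : exists o, pt o = (0, 0)%N.
Proof. by case: PL => _ _ /ptP. Qed.

Lemma pt_join i j : exists z, pt z = join2 (pt i) (pt j).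
Proof. by case: PL => _ sub _ _; apply: ptP; case: (sub _ _ (pt_in i) (pt_in j)). Qed.

Lemma pt_meet i j : exists z, pt z = meet2 (pt i) (pt j).
Proof. by case: PL => _ sub _ _; apply: ptP; case: (sub _ _ (pt_in i) (pt_in j)). Qed.

Definition cmp i j := le2 (pt i) (pt j) || le2 (pt j) (pt i).

Definition is_chain C := [forall i in C, forall j in C, cmp i j].

Lemma is_chainP C : reflect {in C &, forall i j, cmp i j} (is_chain C).
Proof.
apply: (iffP forall_inP) => [h i j iC jC|h i iC].
  by move/forall_inP: (h i iC); apply.
by apply/forall_inP => j jC; apply: h.
Qed.

(** Maximality is phrased as meeting every rank that occurs in [L]; such chains have one element per
    rank and can be compared rank by rank. *)
Definition max_chain C :=
  is_chain C && [forall i, exists j in C, ptrk j == ptrk i].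

Lemma max_chain_cmp C : max_chain C -> {in C &, forall i j, cmp i j}.
Proof. by case/andP => /is_chainP. Qed.

Lemma max_chain_hit C i : max_chain C -> exists2 j, j \in C & ptrk j = ptrk i.
Proof. by case/andP => _ /forallP/(_ i)/exists_inP[j jC /eqP]; exists j. Qed.

Lemma cmp_le i j : cmp i j -> (ptrk i <= ptrk j)%N -> le2 (pt i) (pt j).
Proof. rewrite /cmp /ptrk /csum /le2; case: (pt i) (pt j) => [a b] [c d] /=; lia. Qed.

Lemma cmp_eq i j : cmp i j -> ptrk i = ptrk j -> i = j.
Proof.
move=> c e; apply: ptrk_inj => //; move: c e; rewrite /cmp /ptrk /csum /le2.
case: (pt i) (pt j) => [a b] [c d] /=; lia.
Qed.

Lemma max_chain_uniq C : max_chain C ->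
  {in C &, forall i j, ptrk i = ptrk j -> i = j}.
Proof. by move=> /max_chain_cmp cC i j iC jC; apply: cmp_eq; apply: cC. Qed.

Lemma rank_ex i k : (k <= ptrk i)%N -> exists z, ptrk z = k.
Proof.
have [o oE] := pt_origin; move=> ki.
have [||z [zk _ _]] := @pt_interp (pt o) (pt i) k (pt_in o) (pt_in i).
- by rewrite oE /le2 !leq0n.
- by rewrite oE /csum /= ki.
by exists z.
Qed.

Definition stepN p x := pt x == ((pt p).1, (pt p).2.+1).
Definition stepE p x := pt x == ((pt p).1.+1, (pt p).2).

Lemma unit_cmp p x : cmp p x -> ptrk x = (ptrk p).+1 -> stepN p x || stepE p x.
Proof.
rewrite /cmp /stepN /stepE /ptrk /csum /le2.
case: (pt p) (pt x) => [a b] [c d] /=; rewrite !xpair_eqE; lia.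
Qed.

Lemma max_chain_succ C x z : max_chain C -> x \in C -> (ptrk x < ptrk z)%N ->
  exists2 q, q \in C & stepN x q || stepE x q.
Proof.
move=> mC xC /rank_ex[w wk]; have [q qC qk] := max_chain_hit w mC.
exists q => //; apply: unit_cmp; first exact: (max_chain_cmp mC).
by rewrite qk.
Qed.

Lemma max_chain_pred C x : max_chain C -> x \in C -> (0 < ptrk x)%N ->
  exists2 p, p \in C & stepN p x || stepE p x.
Proof.
move=> mC xC x0; have [w wk] := rank_ex (leq_pred (ptrk x)).
have [p pC pk] := max_chain_hit w mC.
exists p => //; apply: unit_cmp; first exact: (max_chain_cmp mC).
by rewrite pk wk prednK.
Qed.

(* [x] is a left turn of the lattice path [C] that can be flipped to the right
   inside [L]; these are the descents of the shelling of the order complex. *)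
Definition corner C p x q z :=
  [&& p \in C, x \in C, q \in C, stepN p x, stepE x q & stepE p z].

Definition descents C :=
  [set x | [exists p, exists q, exists z, corner C p x q z]].

Lemma descentP C x :
  reflect (exists p q z, corner C p x q z) (x \in descents C).
Proof.
rewrite inE; apply: (iffP existsP) => [[p /existsP[q /existsP[z]]]|[p [q [z]]]].
  by exists p, q, z.
by exists p; apply/existsP; exists q; apply/existsP; exists z.
Qed.

Lemma descents_sub C : descents C \subset C.
Proof. by apply/subsetP => x /descentP[p [q [z /and5P[_ ]]]]. Qed.

(* A rank at which [C] lies to the left of [C'] and [y - x] is maximal along
   [C] is a left turn of [C] that can be flipped inside [L]. *)
Lemma descents_dominate C C' x y : max_chain C -> max_chain C' ->
  descents C \subset C' -> x \in C -> y \in C' -> ptrk x = ptrk y ->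
  ((pt x).2 <= (pt y).2)%N.
Proof.
move=> mC mC' /subsetP sub xC yC' xy; rewrite leqNgt; apply/negP => lt.
pose bad x := (x \in C) && [exists y in C', (ptrk x == ptrk y) && ((pt y).2 < (pt x).2)%N].
have badx : bad x by rewrite /bad xC; apply/exists_inP; exists y; rewrite ?xy ?eqxx.
(* [B] bounds all first coordinates, so [g] is the second coordinate minus the first, shifted to
   avoid truncated subtraction. *)
pose B := (\sum_i (pt i).1)%N.
have leB i : ((pt i).1 <= B)%N by rewrite /B (bigD1 i) //= leq_addr.
pose g i := ((pt i).2 + (B - (pt i).1))%N.
case: (@arg_maxnP _ x bad g badx) => {lt xy yC' xC badx}x /andP[xC].
move=> /exists_inP[{}y yC' /andP[/eqP xy lt]] gmax.
have x0 : (0 < ptrk x)%N by rewrite /ptrk /csum; lia.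
have [p pC px] := max_chain_pred mC xC x0.
(* [x] and [y] differ but have the same rank, so their join has larger rank and [x] is not the top
   of [C]. *)
have [w wE] := pt_join x y.
have xw : (ptrk x < ptrk w)%N.
  move: xy lt; rewrite /ptrk /csum wE /join2.
  by case: (pt x) (pt y) => [a b] [c d] /=; lia.
have [q qC xq] := max_chain_succ mC xC xw.
(* After an east step into [x], the point [p] would still be bad and have a larger [g]. *)
have pN : stepN p x.
  case/orP: px => // pE; exfalso.
  have [y' y'C y'p] := max_chain_hit p mC'.
  have cy : cmp y' y by apply: (max_chain_cmp mC').
  have := leB p; have := leB x; have := gmax p; rewrite /bad pC /g.
  have [lt'|ge'] := ltnP (pt y').2 (pt p).2.
    have -> : [exists y0 in C', (ptrk p == ptrk y0) && ((pt y0).2 < (pt p).2)%N].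
      by apply/exists_inP; exists y'; rewrite ?y'p ?eqxx.
    move/(_ isT); move: pE; rewrite /stepE => /eqP -> /=; lia.
  move=> _ _ _; move: pE cy xy y'p lt ge'.
  rewrite /stepE /cmp /le2 /ptrk /csum => /eqP -> /=.
  by case: (pt p) (pt y) (pt y') => [a b] [c d] [e f] /=; lia.
(* Symmetrically, a north step out of [x] would make [q] bad with a larger [g]. *)
have qE : stepE x q.
  case/orP: xq => // qN; exfalso.
  have [y' y'C y'q] := max_chain_hit q mC'.
  have cy : cmp y y' by apply: (max_chain_cmp mC').
  have := leB q; have := leB x; have := gmax q; rewrite /bad qC /g.
  have [lt'|ge'] := ltnP (pt y').2 (pt q).2.
    have -> : [exists y0 in C', (ptrk q == ptrk y0) && ((pt y0).2 < (pt q).2)%N].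
      by apply/exists_inP; exists y'; rewrite ?y'q ?eqxx.
    move/(_ isT); move: qN; rewrite /stepN => /eqP -> /=; lia.
  move=> _ _ _; move: qN cy xy y'q lt ge'.
  rewrite /stepN /cmp /le2 /ptrk /csum => /eqP -> /=.
  by case: (pt x) (pt y) (pt y') => [a b] [c d] [e f] /=; lia.
(* Since [y] lies strictly to the right of [x], the join of [p] with the meet of [q] and [y] is the
   east neighbour of [p], and [L] contains it as a sublattice. *)
have [u uE] := pt_meet q y; have [z zE] := pt_join p u.
have zpE : stepE p z.
  move: pN qE xy lt; rewrite /stepE /stepN zE uE /join2 /meet2 /ptrk /csum.
  move=> /eqP xp /eqP ->; rewrite xp xpair_eqE /=.
  by case: (pt p) (pt y) => [a b] [c d] /=; lia.
have /sub xC' : x \in descents C.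
  by apply/descentP; exists p, q, z; rewrite /corner pC xC qC pN qE zpE.
by move: lt; rewrite (max_chain_uniq mC' xC' yC' xy) ltnn.
Qed.

(** A chain maximal for inclusion cannot miss the rank of some [i]: interpolating there between its
    nearest elements below and above would enlarge it. Where none exists, the origin and a join with
    [i] serve as ends. *)
Lemma extend_chain D : is_chain D -> exists2 C, max_chain C & D \subset C.
Proof.
move=> cD; have [C maxC DC] := maxset_exists cD.
exists C => //; rewrite /max_chain; have cC := maxsetp maxC; rewrite cC /=.
apply/forallP => i; apply: contraT; rewrite negb_exists => /forallP h.
have noC c : c \in C -> ptrk c != ptrk i by move=> cc; have := h c; rewrite cc.
have cmpC := is_chainP _ cC.
have [o oE] := pt_origin.
have le2_trans a b c : le2 a b -> le2 b c -> le2 a c by rewrite /le2; lia.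
have le2xx a : le2 a a by rewrite /le2 !leqnn.
have [x [xi xC xC']] : exists x, [/\ (ptrk x <= ptrk i)%N,
    forall c, c \in C -> (ptrk c < ptrk i)%N -> le2 (pt c) (pt x) &
    forall c, c \in C -> (ptrk i < ptrk c)%N -> le2 (pt x) (pt c)].
  have [c0 c0P|none] := pickP (fun c => (c \in C) && (ptrk c < ptrk i)%N).
    case: (@arg_maxnP _ c0 (fun c => (c \in C) && (ptrk c < ptrk i)%N) ptrk c0P).
    move=> x /andP[xC xi] xmax; exists x; split=> [|c cC' ci|c cC' ci].
    - exact: ltnW.
    - by apply: cmp_le; [apply: cmpC | apply: xmax; rewrite cC'].
    by apply: cmp_le; [apply: cmpC | apply: ltnW (ltn_trans xi ci)].
  exists o; split=> [|c cC' ci|c _ _]; first by rewrite {1}/ptrk oE.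
    by have := none c; rewrite cC' ci.
  by rewrite oE /le2 !leq0n.
have [y [iy xy yC]] : exists y, [/\ (ptrk i <= ptrk y)%N, le2 (pt x) (pt y) &
    forall c, c \in C -> (ptrk i < ptrk c)%N -> le2 (pt y) (pt c)].
  have [c0 c0P|none] := pickP (fun c => (c \in C) && (ptrk i < ptrk c)%N).
    case: (@arg_minnP _ c0 (fun c => (c \in C) && (ptrk i < ptrk c)%N) ptrk c0P).
    move=> y /andP[yC iy] ymin; exists y; split=> [||c cC' ci].
    - exact: ltnW.
    - exact: xC'.
    by apply: cmp_le; [apply: cmpC | apply: ymin; rewrite cC'].
  have [w wE] := pt_join x i; exists w; rewrite /ptrk /csum wE; split.
  - by rewrite /join2 /=; lia.
  - by rewrite /join2 /le2 /=; lia.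
  by move=> c cC' ci; have := none c; rewrite cC' ci.
have [|z [zi xz zy]] := pt_interp (pt_in x) (pt_in y) xy (k := ptrk i).
  by apply/andP.
have zC c : c \in C -> cmp z c.
  move=> cc; rewrite /cmp; have := noC c cc.
  case: ltngtP => // [ci|ic] _; apply/orP; [right|left].
    exact: le2_trans (xC c cc ci) xz.
  exact: le2_trans zy (yC c cc ic).
have cz : is_chain (z |: C).
  apply/is_chainP => a b; rewrite !in_setU1.
  case/predU1P=> [->|aC] /predU1P[->|bC]; [by rewrite /cmp le2xx|exact: zC| |].
    by rewrite /cmp orbC; apply: zC.
  exact: cmpC.
have zCE := (maxsetP maxC).2 _ cz (subsetUr _ _).
by have := noC z; rewrite -zCE setU11 zi eqxx => /(_ isT).
Qed.

Definition area C := (\sum_(i in C) (pt i).2)%N.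

Lemma flip_max_chain C p x q z : max_chain C -> corner C p x q z ->
  max_chain (z |: C :\ x).
Proof.
move=> mC /and5P[pC xC qC /eqP px /andP[/eqP xq /eqP pz]].
have cC := max_chain_cmp mC.
have zx : ptrk z = ptrk x by rewrite /ptrk /csum pz px /=; lia.
have zc c : c \in C :\ x -> cmp z c.
  rewrite in_setD1 => /andP[cx cC'].
  have crk : ptrk c != ptrk x.
    by apply: contraNneq cx => /(max_chain_uniq mC cC' xC) ->.
  have := cC _ _ cC' pC; have := cC _ _ cC' qC; move: crk.
  rewrite /cmp /le2 /ptrk /csum xq px pz.
  by case: (pt p) (pt c) => [a b] [e f] /=; lia.
apply/andP; split.
  apply/is_chainP => a b; rewrite !in_setU1.
  case/predU1P=> [->|aC] /predU1P[->|bC].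
  - by rewrite /cmp /le2 !leqnn.
  - exact: zc.
  - by rewrite /cmp orbC; apply: zc.
  by move: aC bC; rewrite !in_setD1 => /andP[_ aC] /andP[_ bC]; apply: cC.
apply/forallP => i; apply/exists_inP; have [j jC ji] := max_chain_hit i mC.
have [jx|jx] := eqVneq j x.
  by exists z; rewrite ?setU11 // zx -jx ji.
by exists j; rewrite ?ji // in_setU1 in_setD1 jx jC orbT.
Qed.

Lemma area_flip C p x q z : max_chain C -> corner C p x q z ->
  (area (z |: C :\ x) < area C)%N.
Proof.
move=> mC /and5P[pC xC qC /eqP px /andP[/eqP xq /eqP pz]].
have zx : ptrk z = ptrk x by rewrite /ptrk /csum pz px /=; lia.
have zC : z \notin C :\ x.
  rewrite in_setD1; apply/negP => /andP[/eqP zx' zC].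
  by apply: zx'; apply: (max_chain_uniq mC).
rewrite /area big_setU1 //= [X in (_ < X)%N](big_setD1 x) //=.
by rewrite ltn_add2r pz px /=.
Qed.

(** Take a maximal chain through [D] of least [area]: flipping a descent outside [D] would keep it
    through [D] and lower the area. *)
Lemma chain_between D : is_chain D ->
  exists2 C, max_chain C & (descents C \subset D) && (D \subset C).
Proof.
move=> cD; have [C0 mC0 DC0] := extend_chain cD.
have C0P : max_chain C0 && (D \subset C0) by rewrite mC0.
case: (@arg_minnP _ C0 (fun C => max_chain C && (D \subset C)) area C0P).
move=> C /andP[mC DC] Cmin; exists C => //; rewrite DC andbT.
apply/subsetP => x /descentP[p [q [z co]]]; apply: contraT => xD.
have := area_flip mC co; rewrite ltnNge Cmin // (flip_max_chain mC co) /=.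
apply/subsetP => c cD'; rewrite in_setU1 in_setD1 (subsetP DC) // andbT.
by rewrite (_ : c != x) ?orbT //; apply: contraNneq xD => <-.
Qed.

(** Each chain dominates the other, so they have the same second coordinate in every rank. *)
Lemma max_chain_eq C C' : max_chain C -> max_chain C' ->
  descents C \subset C' -> descents C' \subset C -> C = C'.
Proof.
move=> mC mC' s s'; suff sub D D' : max_chain D -> max_chain D' ->
    descents D \subset D' -> descents D' \subset D -> D \subset D'.
  by apply/eqP; rewrite eqEsubset; apply/andP; split; apply: sub.
move=> mD mD' h h'; apply/subsetP => x xD.
have [y yD' yx] := max_chain_hit x mD'.
have -> // : x = y; apply: ptrk_inj => //; apply/eqP; rewrite eqn_leq.
by rewrite (descents_dominate mD mD') // (descents_dominate mD' mD).
Qed.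

End PlanarChains.

(** * Standard monomials *)

Section Monomials.
Variables (K : fieldType) (L : seq (nat * nat)).
Hypothesis PL : planar_distr_lattice L.
Local Notation n := (size L).
Local Notation S := {mpoly K[n]}.
Local Notation I := (in_hibi_ideal (K := K) (L := L)).
Local Notation pt := (pt (L := L)).
Local Notation ptrk := (ptrk (L := L)).
Implicit Types (i j x y z p q : 'I_n) (C D : {set 'I_n}) (m t : 'X_{1..n}).

Lemma hibi_ideal0 : I 0.
Proof. by exists (fun=> 0); rewrite big1 // => i _; rewrite mul0r. Qed.

Lemma hibi_idealD (f g : S) : I f -> I g -> I (f + g).
Proof.
move=> [c ->] [d ->]; exists (fun k => c k + d k); rewrite -big_split.
by apply: eq_bigr => i _; rewrite mulrDl.
Qed.

Lemma hibi_idealM (f g : S) : I g -> I (f * g).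
Proof.
move=> [c ->]; exists (fun k => f * c k); rewrite mulr_sumr.
by apply: eq_bigr => i _; rewrite mulrA.
Qed.

Lemma hibi_gens_ideal (f : S) : f \in hibi_gens K L -> I f.
Proof.
move=> fg; have lt : (index f (hibi_gens K L) < size (hibi_gens K L))%N by rewrite index_mem.
exists (fun k => (k == Ordinal lt)%:R); rewrite (bigD1 (Ordinal lt)) //= big1.
  by rewrite eqxx mul1r addr0 nth_index.
by move=> i /negPf ->; rewrite mul0r.
Qed.

Lemma xvarE i : xvar K L (pt i) = 'X_i.
Proof.
rewrite /xvar (big_pred1 i) // => j /=.
by rewrite -/(pt j) (inj_eq (pt_inj PL)).
Qed.

Lemma hibi_relation i j u w : ~~ cmp i j ->
  pt u = join2 (pt i) (pt j) -> pt w = meet2 (pt i) (pt j) ->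
  I ('X_i * 'X_j - 'X_u * 'X_w).
Proof.
move=> ij ju mw; apply: hibi_gens_ideal; rewrite -!xvarE ju mw.
apply/allpairsPdep; exists (pt i), (pt j); split=> //; first exact: pt_in.
by rewrite mem_filter pt_in andbT /incomp2 -negb_or.
Qed.

(** The [.+2] leaves room for box bounds one past a coordinate, as [mbox_det] uses them, inside
    ['I_W]. *)
Definition wtbound := (\sum_i ((pt i).1 + (pt i).2)).+2.
Local Notation W := wtbound.

Lemma pt_bound i : ((pt i).1.+1 < W)%N /\ ((pt i).2.+1 < W)%N.
Proof. by rewrite /W (bigD1 i) //=; split; lia. Qed.

(* The toric parametrisation, written in coordinates for which the exponents
   of the image of a monomial are its cumulative row and column sums. *)
Definition wt1 i : 'X_{1..W + W} :=
  [multinom (match split k with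
             | inl s => ((pt i).1 < s)%N | inr s => ((pt i).2 < s)%N end : nat) | k < W + W].

Definition wt m : 'X_{1..W + W} := (\sum_i wt1 i *+ m i)%MM.

Definition toric : S -> {mpoly K[W + W]} := mmap (@mpolyC _ K) (fun i => 'X_[wt1 i]).

HB.instance Definition _ := GRing.RMorphism.on toric.

Lemma toricX m : toric 'X_[m] = 'X_[wt m].
Proof. by rewrite /toric mmapX /mmap1 mprodXnE. Qed.

Lemma toricXU i : toric 'X_i = 'X_[wt1 i].
Proof. by rewrite /toric mmapX mmap1U. Qed.

Lemma wt1_lattice i j u w :
  pt u = join2 (pt i) (pt j) -> pt w = meet2 (pt i) (pt j) ->
  (wt1 i + wt1 j = wt1 u + wt1 w)%MM.
Proof.
move=> ju mw; apply/mnmP => k; rewrite !mnmDE !mnmE ju mw /join2 /meet2 /=.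
by case: (split k) => s; case: (pt i) (pt j) => [a b] [c d] /=; lia.
Qed.

Lemma toric_ideal f : I f -> toric f = 0.
Proof.
move=> [c ->]; rewrite rmorph_sum big1 // => i _; rewrite rmorphM /=.
have /allpairsPdep[a [b [aL]]] : (hibi_gens K L)`_i \in hibi_gens K L by exact: mem_nth.
rewrite mem_filter => /andP[_ bL ->].
have [j <-] := ptP aL; have [k <-] := ptP bL.
have [u uE] := pt_join PL j k; have [w wE] := pt_meet PL j k.
rewrite -uE -wE !xvarE rmorphB !rmorphM /= !toricXU -!mpolyXD.
by rewrite (wt1_lattice uE wE) subrr mulr0.
Qed.

Lemma wtD m m' : (wt (m + m') = wt m + wt m')%MM.
Proof.
rewrite /wt -big_split; apply: eq_bigr => i _.
by apply/mnmP => k; rewrite !mnmDE !mulmnE mulnDr.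
Qed.

Lemma wtU i : wt U_(i) = wt1 i.
Proof.
apply/mnmP => k; rewrite /wt mnm_sumE (bigD1 i) //= mulmnE mnm1E eqxx muln1.
by rewrite big1 ?addn0 // => j /negPf ji; rewrite mulmnE mnm1E eq_sym ji muln0.
Qed.

Definition msum (F : 'I_n -> nat) m := (\sum_i m i * F i)%N.
(** Join and meet of an incomparable pair have the same rank sum as the pair but lie further apart,
    so by convexity straightening raises the sum of squared ranks. *)
Definition mQ := msum (fun i => ptrk i * ptrk i)%N.
Definition mY := msum (fun i => (pt i).2).

Lemma msumD F m m' : msum F (m + m') = (msum F m + msum F m')%N.
Proof. by rewrite /msum -big_split; apply: eq_bigr => i _; rewrite mnmDE mulnDl. Qed.

Lemma msumU F i : msum F U_(i) = F i.
Proof.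
rewrite /msum (bigD1 i) //= mnm1E eqxx mul1n big1 ?addn0 // => j /negPf ji.
by rewrite mnm1E eq_sym ji.
Qed.

Lemma msum_bound F m : (msum F m <= mdeg m * \sum_i F i)%N.
Proof.
rewrite mdegE big_distrl /=; apply: leq_sum => i _; rewrite leq_mul2l.
by rewrite [X in (_ <= X)%N](bigD1 i) //= leq_addr orbT.
Qed.

Definition msup m : {set 'I_n} := [set i | m i != 0%N].
Definition standard m := is_chain (msup m).

Lemma straighten m : ~~ standard m -> exists m',
  [/\ wt m' = wt m, mdeg m' = mdeg m, (mQ m < mQ m')%N & I ('X_[m] - 'X_[m'])].
Proof.
rewrite /standard /is_chain negb_forall => /existsP[i].
rewrite negb_imply negb_forall => /andP[im /existsP[j]].
rewrite negb_imply => /andP[jm ij]; rewrite !inE in im jm.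
have [u uE] := pt_join PL i j; have [w wE] := pt_meet PL i j.
have nij : i != j by apply: contraNneq ij => ->; rewrite /cmp /le2 !leqnn.
pose m0 := (m - U_(i) - U_(j))%MM.
have mE : m = (U_(i) + U_(j) + m0)%MM.
  apply/mnmP => k; rewrite !mnmDE !mnmBE !mnm1E.
  have [<-|ik] := eqVneq i k; first by rewrite eq_sym (negPf nij); lia.
  by have [<-|jk] := eqVneq j k; lia.
exists (U_(u) + U_(w) + m0)%MM; rewrite {1 2 3 4}mE; split.
- by rewrite !wtD !wtU (wt1_lattice uE wE).
- by rewrite !mdegD !mdeg1.
- rewrite /mQ !msumD !msumU ltn_add2r; move: ij.
  rewrite /cmp /le2 /ptrk /csum uE wE /join2 /meet2.
  by case: (pt i) (pt j) => [a b] [c d] /=; nia.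
rewrite !mpolyXD -mulrBl mulrC; apply: hibi_idealM.
exact: hibi_relation.
Qed.

Definition mbox m a b := (\sum_(i | ((pt i).1 < a) && ((pt i).2 < b)) m i)%N.

(* For a chain, one of the two conditions of the box implies the other. *)
Lemma mbox_std m (a b : 'I_W) : standard m ->
  mbox m a b = minn (wt m (lshift W a)) (wt m (rshift W b)).
Proof.
move=> /is_chainP cm.
have wl : wt m (lshift W a) = (\sum_(i | ((pt i).1 < a)%N) m i)%N.
  rewrite /wt mnm_sumE [RHS]big_mkcond; apply: eq_bigr => i _.
  by rewrite mulmnE mnmE (unsplitK (inl a)); case: ltnP; rewrite ?mul1n.
have wr : wt m (rshift W b) = (\sum_(i | ((pt i).2 < b)%N) m i)%N.
  rewrite /wt mnm_sumE [RHS]big_mkcond; apply: eq_bigr => i _.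
  by rewrite mulmnE mnmE (unsplitK (inr b)); case: ltnP; rewrite ?mul1n.
rewrite wl wr; apply/eqP; rewrite eqn_leq leq_min; apply/andP; split.
  apply/andP; split; rewrite /mbox big_mkcond [X in (_ <= X)%N]big_mkcond;
    by apply: leq_sum => i _; case: (_ < a)%N; case: (_ < b)%N => /=.
rewrite geq_min.
have [i /and3P[im i1 i2]|none] := pickP (fun i => [&& i \in msup m, ((pt i).1 < a)%N & (b <= (pt i).2)%N]).
  apply/orP; right; rewrite /mbox big_mkcond [X in (_ <= X)%N]big_mkcond.
  apply: leq_sum => j _; case: (ltnP _ b) => // j2; case: ltnP => // j1.
  have [jm|] := boolP (j \in msup m); last by rewrite inE negbK => /eqP ->.
  have := cm i j im jm; move: i1 i2 j1 j2; rewrite /cmp /le2.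
  by case: (pt i) (pt j) => [c d] [e f] /=; lia.
apply/orP; left; rewrite /mbox big_mkcond [X in (_ <= X)%N]big_mkcond.
apply: leq_sum => j _; case: (ltnP _ a) => // j1; case: ltnP => // j2.
have := none j; rewrite j1 j2 !andbT inE => /negbFE/eqP ->.
by [].
Qed.

(** Inclusion-exclusion, written without subtraction: exponents are second differences of box
    counts. By [mbox_std] the weight gives the box counts of a standard monomial, hence the
    monomial. *)
Lemma mbox_det m i : let: (a, b) := pt i in
  (m i + mbox m a b.+1 + mbox m a.+1 b = mbox m a.+1 b.+1 + mbox m a b)%N.
Proof.
case e : (pt i) => [a b].
have sp P (Q : pred 'I_n) : (\sum_(j | P j) m j =
    \sum_(j | P j && Q j) m j + \sum_(j | P j && ~~ Q j) m j)%N.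
  exact: bigID.
rewrite /mbox (sp (fun j => ((pt j).1 < a.+1) && ((pt j).2 < b.+1))%N (fun j => (pt j).1 < a)%N).
rewrite (sp (fun j => ((pt j).1 < a.+1) && ((pt j).2 < b))%N (fun j => (pt j).1 < a)%N).
rewrite [X in _ = (_ + X + _)%N](bigD1 i) /=; last by rewrite e /=; lia.
have -> : (\sum_(j | ((pt j).1 < a.+1) && ((pt j).2 < b.+1) && ((pt j).1 < a)) m j =
    \sum_(j | ((pt j).1 < a) && ((pt j).2 < b.+1)) m j)%N.
  by apply: eq_bigl => j; lia.
have -> : (\sum_(j | ((pt j).1 < a.+1) && ((pt j).2 < b) && ((pt j).1 < a)) m j =
    \sum_(j | ((pt j).1 < a) && ((pt j).2 < b)) m j)%N.
  by apply: eq_bigl => j; lia.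
have -> : (\sum_(j | ((pt j).1 < a.+1) && ((pt j).2 < b.+1) && ~~ ((pt j).1 < a) && (j != i)) m j =
    \sum_(j | ((pt j).1 < a.+1) && ((pt j).2 < b) && ~~ ((pt j).1 < a)) m j)%N.
  apply: eq_bigl => j; have -> : (j == i) = ((pt j).1 == a) && ((pt j).2 == b).
    by rewrite -(inj_eq (pt_inj PL)) e; case: (pt j).
  by lia.
have ac (u v w s : nat) : (u + v + (w + s) = v + (u + s) + w)%N by lia.
exact: ac.
Qed.

Lemma standard_inj m m' : standard m -> standard m' -> wt m = wt m' -> m = m'.
Proof.
move=> sm sm' e; apply/mnmP => i.
have := mbox_det m i; have := mbox_det m' i; have := pt_bound i.
case: (pt i) => [a b] /= [aW bW].
have eq_box (c d : nat) : (c < W)%N -> (d < W)%N -> mbox m c d = mbox m' c d.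
  by move=> cW dW; rewrite -[c]/(Ordinal cW : nat) -[d]/(Ordinal dW : nat) !mbox_std // e.
by rewrite !eq_box //; lia.
Qed.

(** Straightening keeps [wt] and [mdeg] and raises [mQ], which is bounded in each degree. It
    therefore stops, and by [standard_inj] it can only stop at [M]. *)
Lemma standard_max M m : standard M -> wt m = wt M -> m = M \/ (mQ m < mQ M)%N.
Proof.
move=> sM; have [k] := ubnP (mdeg m * \sum_i (ptrk i * ptrk i) - mQ m)%N.
elim: k m => // k IH m mk wm.
have [sm|nsm] := boolP (standard m); first by left; apply: standard_inj.
have [m' [wm' dm' Qm' _]] := straighten nsm; right.
have bm' : (mQ m' <= mdeg m' * \sum_i (ptrk i * ptrk i))%N by exact: msum_bound.
have lt : (mdeg m' * \sum_i (ptrk i * ptrk i) - mQ m' < k)%N.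
  by move: bm' mk; rewrite dm'; lia.
have [m'M|] := IH m' lt (etrans wm' wm); first by rewrite -m'M.
exact: ltn_trans.
Qed.

End Monomials.

(** * A free basis of the Hibi ring *)

Section StandardBasis.
Variables (K : fieldType) (L : seq (nat * nat)).
Hypothesis PL : planar_distr_lattice L.
Local Notation n := (size L).
Local Notation S := {mpoly K[n]}.
Local Notation I := (in_hibi_ideal (K := K) (L := L)).
Local Notation pt := (pt (L := L)).
Local Notation ptrk := (ptrk (L := L)).
Implicit Types (i j x y z : 'I_n) (C D : {set 'I_n}) (m t : 'X_{1..n}).
Implicit Types (f g : 'I_n -> 'I_n).

(** The exponent of the image of ['X_[m]] under the substitution of ['X_(f j)] for ['X_j]. *)
Definition push f m : 'X_{1..n} := (\sum_j U_(f j) *+ m j)%MM.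

Lemma pushD f m m' : (push f (m + m') = push f m + push f m')%MM.
Proof.
rewrite /push -big_split; apply: eq_bigr => i _.
by apply/mnmP => k; rewrite !mnmDE !mulmnE mulnDr.
Qed.

Lemma push0 f : push f 0%MM = 0%MM.
Proof.
rewrite /push big1 // => i _.
by apply/mnmP => k; rewrite mulmnE !mnm0E muln0.
Qed.

Lemma pushE f m k : push f m k = (\sum_j (f j == k) * m j)%N.
Proof. by rewrite /push mnm_sumE; apply: eq_bigr => j _; rewrite mulmnE mnm1E. Qed.

Lemma msum_push F f m : msum F (push f m) = msum (F \o f) m.
Proof.
rewrite /msum; transitivity (\sum_k \sum_j (f j == k) * m j * F k)%N.
  by apply: eq_bigr => k _; rewrite pushE big_distrl.
rewrite exchange_big; apply: eq_bigr => j _ /=.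
rewrite (bigD1 (f j)) //= eqxx mul1n big1 ?addn0 // => k /negPf fk.
by rewrite eq_sym fk.
Qed.

Lemma push_id f m : (forall j, m j != 0%N -> f j = j) -> push f m = m.
Proof.
move=> fid; apply/mnmP => k; rewrite pushE (bigD1 k) //=.
rewrite big1 ?addn0 => [|j /negPf jk].
  by have [->|/fid ->] := eqVneq (m k) 0%N; rewrite ?muln0 // eqxx mul1n.
by have [->|/fid ->] := eqVneq (m j) 0%N; rewrite ?muln0 // jk.
Qed.

Lemma push_comp f g m : push g (push f m) = push (g \o f) m.
Proof.
apply/mnmP => k; rewrite !pushE.
have := msum_push (fun j => (g j == k) : nat) f m; rewrite /msum /= => e.
transitivity (\sum_i push f m i * (g i == k))%N.
  by apply: eq_bigr => i _; rewrite mulnC.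
by rewrite e; apply: eq_bigr => i _; rewrite mulnC.
Qed.

Lemma eq_push f g m : f =1 g -> push f m = push g m.
Proof. by move=> fg; apply: eq_bigr => j _; rewrite fg. Qed.

Lemma pushU f i : push f U_(i)%MM = U_(f i)%MM.
Proof.
apply/mnmP => k; rewrite pushE (bigD1 i) //= mnm1E eqxx muln1 mnm1E.
by rewrite big1 ?addn0 // => j /negPf ji; rewrite mnm1E [i == j]eq_sym ji muln0.
Qed.

Lemma mdeg_msum m : mdeg m = msum (fun=> 1%N) m.
Proof. by rewrite mdegE; apply: eq_bigr => i _; rewrite muln1. Qed.

Lemma mdeg_push f m : mdeg (push f m) = mdeg m.
Proof. by rewrite !mdeg_msum msum_push. Qed.

(** One chosen element per rank, whose variable is traded for the rank sum theta. Monomials in the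
    thetas are encoded by exponents [t] with [push base t = t]. *)
Definition base i := odflt i [pick j | ptrk j == ptrk i].

Lemma base_rk i : ptrk (base i) = ptrk i.
Proof. by rewrite /base; case: pickP => [j /eqP|]. Qed.

Lemma base_eq i j : ptrk i = ptrk j -> base i = base j.
Proof.
move=> ij; rewrite /base; have -> : [pick k | ptrk k == ptrk i] = [pick k | ptrk k == ptrk j].
  by apply: eq_pick => k; rewrite ij.
by case: pickP => // /(_ j); rewrite eqxx.
Qed.

Lemma baseK i : base (base i) = base i.
Proof. by apply: base_eq; apply: base_rk. Qed.

Definition at_rank C i := odflt i [pick j in C | ptrk j == ptrk i].

Lemma at_rankP C i : max_chain C -> at_rank C i \in C /\ ptrk (at_rank C i) = ptrk i.
Proof.
move=> mC; rewrite /at_rank; case: pickP => [j /andP[jC /eqP]|] //= none.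
by have [j jC ji] := max_chain_hit i mC; have := none j; rewrite jC ji eqxx.
Qed.

Lemma at_rank_id C i : max_chain C -> i \in C -> at_rank C i = i.
Proof.
by move=> mC iC; have [aC ai] := at_rankP i mC; apply: (max_chain_uniq PL mC).
Qed.

Lemma at_rank_base C i : max_chain C -> at_rank C (base i) = at_rank C i.
Proof.
move=> mC; have [aC ai] := at_rankP i mC; have [bC bi] := at_rankP (base i) mC.
by apply: (max_chain_uniq PL mC) => //; rewrite ai bi base_rk.
Qed.

Lemma base_at_rank C i : max_chain C -> base (at_rank C i) = base i.
Proof. by move=> mC; apply: base_eq; case: (at_rankP i mC). Qed.

Definition nonbase := [set i | base i != i].

(** The images of the variables under the linear change of coordinates; [rank_diff] gives the
    inverse. *)
Definition rank_sum i : S := if base i == i then \sum_(j | base j == i) 'X_j else 'X_i.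

Definition rank_diff i : S :=
  if base i == i then 'X_i - \sum_(j | (base j == i) && (j != i)) 'X_j else 'X_i.

Local Notation phi := (subst rank_sum).

Lemma rank_sum_homog i : rank_sum i \is 1.-homog.
Proof.
rewrite /rank_sum; case: ifP => _; last by rewrite dhomogX /= mdeg1.
by apply: rpred_sum => j _; rewrite dhomogX /= mdeg1.
Qed.

Lemma rank_diff_homog i : rank_diff i \is 1.-homog.
Proof.
have X1 j : ('X_j : S) \is 1.-homog by rewrite dhomogX /= mdeg1.
rewrite /rank_diff; case: ifP => _ //.
by apply: rpredB => //; apply: rpred_sum.
Qed.

Lemma rank_sumK : cancel (subst rank_diff) (subst rank_sum).
Proof.
apply: substK => i; rewrite /rank_diff; case: ifP => bi; last first.
  by rewrite substX /rank_sum bi.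
rewrite rmorphB rmorph_sum /= substX {1}/rank_sum bi (bigD1 i) //=.
rewrite [X in _ - X](eq_bigr (fun j => 'X_j)) ?addrK // => j /andP[/eqP bj ji].
by rewrite substX /rank_sum bj eq_sym (negPf ji).
Qed.

Lemma rank_diffK : cancel (subst rank_sum) (subst rank_diff).
Proof.
apply: substK => i; rewrite /rank_sum; case: ifP => bi; last first.
  by rewrite substX /rank_diff bi.
rewrite rmorph_sum (bigD1 i) //= substX {1}/rank_diff bi.
rewrite [X in _ + X](eq_bigr (fun j => 'X_j)) ?subrK // => j /andP[/eqP bj ji].
by rewrite substX /rank_diff bj eq_sym (negPf ji).
Qed.

Definition dmon C : 'X_{1..n} := [multinom (x \in descents C : nat) | x < n].

(** The leading monomial of theta^t eta_C: every theta is replaced by the variable of its rank on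
    [C]. *)
Definition lead C t := (push (at_rank C) t + dmon C)%MM.

Lemma mdeg_dmon C : mdeg (dmon C) = #|descents C|.
Proof.
rewrite mdegE -sum1_card [RHS]big_mkcond; apply: eq_bigr => i _.
by rewrite mnmE; case: (i \in _).
Qed.

Lemma lead_sup C t : max_chain C -> msup (lead C t) \subset C.
Proof.
move=> mC; apply/subsetP => x; rewrite inE mnmDE; apply: contraNT => xC.
rewrite mnmE (contraNF (subsetP (descents_sub C) x) xC) addn0 pushE big1 // => j _.
have [aC _] := at_rankP j mC; case: eqP => // ax; by rewrite -ax aC in xC.
Qed.

Lemma descents_lead C t : descents C \subset msup (lead C t).
Proof. by apply/subsetP => x xD; rewrite inE mnmDE [dmon C x]mnmE xD addn_eq0 andbF. Qed.

Lemma chain_sub C D : D \subset C -> is_chain C -> is_chain D.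
Proof.
move=> /subsetP DC /is_chainP cC; apply/is_chainP => i j iD jD.
by apply: cC; apply: DC.
Qed.

Lemma lead_standard C t : max_chain C -> standard (lead C t).
Proof. by move=> mC; apply: chain_sub (lead_sup t mC) _; case/andP: mC. Qed.

(** The support of a leading monomial contains the descents of its chain and stays on that chain, so
    [max_chain_eq] recovers [C]; dividing by the descents and applying [base] recovers [t]. *)
Lemma lead_inj C C' t t' : max_chain C -> max_chain C' ->
  push base t = t -> push base t' = t' -> lead C t = lead C' t' ->
  C = C' /\ t = t'.
Proof.
move=> mC mC' bt bt' e.
have CC : C = C'.
  apply: (max_chain_eq PL mC mC').
    by apply: subset_trans (descents_lead C t) _; rewrite e lead_sup.
  by apply: subset_trans (descents_lead C' t') _; rewrite -e lead_sup.
split=> //; move: e; rewrite -CC => /addIm/(congr1 (push base)).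
rewrite !push_comp; have bE : base \o at_rank C =1 base.
  by move=> i /=; apply: base_at_rank.
by rewrite !(eq_push _ bE) bt bt'.
Qed.

Lemma standard_lead C m : max_chain C -> descents C \subset msup m ->
  msup m \subset C -> exists t, [/\ push base t = t & m = lead C t].
Proof.
move=> mC /subsetP Dm /subsetP mC'; pose m1 := (m - dmon C)%MM.
have mE : m = (m1 + dmon C)%MM.
  apply/mnmP => x; rewrite mnmDE mnmBE [dmon C x]mnmE.
  have [/Dm|] := boolP (x \in descents C); last by rewrite subn0 addn0.
  by rewrite inE -lt0n => lt; rewrite subnK.
exists (push base m1); split.
  by rewrite push_comp; apply: eq_push => i /=; apply: baseK.
rewrite /lead push_comp {1}mE; congr (_ + _)%MM.
rewrite (eq_push (g := at_rank C)) => [|i /=]; last exact: at_rank_base.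
rewrite push_id // => j mj; apply: at_rank_id => //; apply: mC'.
by rewrite inE mE mnmDE addn_eq0 negb_and mj.
Qed.

(** The shape of theta^t seen from [C]: all monomials have rank content [t], and exactly one, with
    coefficient 1, is supported on [C]. *)
Definition expands C (p : S) t := push base t = t /\ exists z : S,
  p = 'X_[push (at_rank C) t] + z /\
  forall m, m \in msupp z -> push base m = t /\ ~~ (msup m \subset C).

Lemma expands1 C : expands C 1 0%MM.
Proof.
split; first by rewrite push0.
by exists 0; rewrite push0 mpolyX0 addr0; split=> // m; rewrite msupp0.
Qed.

(** A product of monomials is supported on [C] only if both factors are, so the cross terms all
    leave [C]. *)
Lemma expandsM C p q t t' : max_chain C ->
  expands C p t -> expands C q t' -> expands C (p * q) (t + t')%MM.
Proof.
move=> mC [bt [z [-> zP]]] [bt' [z' [-> zP']]]; split; first by rewrite pushD bt bt'.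
have bE u : push base u = u -> push base (push (at_rank C) u) = u.
  move=> bu; rewrite push_comp -[RHS]bu.
  by apply: eq_push => i /=; apply: base_at_rank.
have supD m m' : (msup m \subset msup (m + m')) && (msup m' \subset msup (m + m')).
  by apply/andP; split; apply/subsetP => x; rewrite !inE mnmDE; lia.
have nsub m m' : ~~ (msup m \subset C) || ~~ (msup m' \subset C) ->
    ~~ (msup (m + m') \subset C).
  have /andP[s s'] := supD m m'.
  by case/orP; apply: contraNN; apply: subset_trans.
exists ('X_[push (at_rank C) t] * z' + z * ('X_[push (at_rank C) t'] + z')).
split; first by rewrite pushD mpolyXD mulrDl !mulrDr !addrA.
move=> m /msuppD_le; rewrite mem_cat => /orP[] /msuppM_le/allpairsP[[m1 m2] /= [h1 h2 ->]].
  move: h1; rewrite msuppX inE => /eqP ->; have [b2 n2] := zP' _ h2.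
  by rewrite pushD bE // b2; split=> //; apply: nsub; rewrite n2 orbT.
have [b1 n1] := zP _ h1; split; last by apply: nsub; rewrite n1.
rewrite pushD b1; congr (_ + _)%MM; move: h2 => /msuppD_le; rewrite mem_cat => /orP[].
  by rewrite msuppX inE => /eqP ->; rewrite bE.
by move=> /zP'[].
Qed.

Lemma expandsX C i : max_chain C -> base i = i -> expands C (phi 'X_i) U_(i)%MM.
Proof.
move=> mC bi; have [aC ai] := at_rankP i mC.
split; first by rewrite pushU bi.
have ba : base (at_rank C i) == i by rewrite base_at_rank // bi.
exists (\sum_(j | (base j == i) && (j != at_rank C i)) 'X_j); split.
  by rewrite substX /rank_sum bi eqxx (bigD1 (at_rank C i)) //= pushU.
move=> m mz; have [j /andP[/andP[/eqP bj ja] mj]] : exists j,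
    ((base j == i) && (j != at_rank C i)) && (m == U_(j)%MM).
  apply/existsP; move: mz; apply: contraLR; rewrite negb_exists => /forallP none.
  rewrite -mcoeff_eq0 raddf_sum big1 // => j cj /=; rewrite mcoeffX eq_sym.
  by have := none j; rewrite cj /= => /negPf ->.
rewrite (eqP mj) pushU bj; split=> //; apply/subsetPn; exists j.
  by rewrite inE mnm1E eqxx.
apply: contra ja => jC; apply/eqP/(max_chain_uniq PL mC) => //.
by rewrite ai -bj base_rk.
Qed.

Lemma expands_phi C t : max_chain C -> push base t = t -> expands C (phi 'X_[t]) t.
Proof.
move=> mC bt; rewrite mpolyXE_id rmorph_prod {2}(multinomUE_id t).
have t0 i : base i != i -> t i = 0%N.
  move=> bi; rewrite -bt pushE big1 // => j _.
  by case: eqP => // bj; rewrite -bj baseK eqxx in bi.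
apply: (big_ind2 (expands C)) => [|p t1 q t2|i _].
- exact: expands1.
- exact: expandsM.
rewrite rmorphXn /=; have [bi|/eqP/t0 ->] := base i =P i; last first.
  by rewrite expr0 mulm0n; apply: expands1.
elim: (t i) => [|k IH]; first by rewrite expr0 mulm0n; apply: expands1.
by rewrite exprS mulmS; apply: expandsM => //; apply: expandsX.
Qed.

(** A standard monomial of [z] lies on a maximal chain [C'] through the descents of [C], so [C']
    dominates [C] and no second coordinate drops. It also leaves [C] somewhere, which makes the
    inequality strict. *)
Lemma phi_eta_expand C t : max_chain C -> push base t = t ->
  exists z : S, phi 'X_[t] * 'X_[dmon C] = 'X_[lead C t] + z /\
    forall m, m \in msupp z -> [/\ mQ m = mQ (lead C t), mdeg m = mdeg (lead C t)
      & standard m -> (mY (lead C t) < mY m)%N].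
Proof.
move=> mC bt; have [_ [z [-> zP]]] := expands_phi mC bt.
exists (z * 'X_[dmon C]); split; first by rewrite mulrDl /lead mpolyXD.
move=> m /msuppM_le/allpairsP[[m1 m2] /= [/zP[b1 n1] + ->]].
rewrite msuppX inE => /eqP -> {m m2}.
have msE F : (forall i j, ptrk i = ptrk j -> F i = F j) ->
    msum F m1 = msum F (push (at_rank C) t).
  move=> Fr; rewrite -b1 !msum_push; apply: eq_bigr => i _ /=; congr (_ * _)%N.
  by apply: Fr; rewrite (at_rankP _ mC).2 base_rk.
split.
- by rewrite /mQ !msumD msE // => i j ->.
- by rewrite !mdeg_msum !msumD (msE (fun=> 1%N)).
move=> sm; have [C' mC' /andP[_ mC'']] := chain_between PL sm.
have sub m' : msup m' \subset C' -> (forall x, m' x != 0%N -> x \in C').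
  by move=> /subsetP s x mx; apply: s; rewrite inE.
have dC' : descents C \subset C'.
  apply/subsetP => x xD; apply: (sub _ mC''); rewrite mnmDE [dmon C x]mnmE xD.
  by rewrite addn_eq0 andbF.
have m1C' x : m1 x != 0%N -> x \in C'.
  by move=> mx; apply: (sub _ mC''); rewrite mnmDE addn_eq0 negb_and mx.
have dom x : m1 x != 0%N -> ((pt (at_rank C x)).2 <= (pt x).2)%N.
  move=> mx; have [aC ax] := at_rankP x mC.
  exact: (descents_dominate PL mC mC' dC' aC (m1C' x mx) ax).
rewrite /mY /lead !msumD ltn_add2r -b1 !msum_push /msum.
have [x xm xC] := subsetPn n1; have mx : m1 x != 0%N by rewrite inE in xm.
rewrite (bigD1 x) //= [X in (_ < X)%N](bigD1 x) //= -addSn; apply: leq_add.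
  rewrite ltn_pmul2l ?lt0n // at_rank_base // ltn_neqAle dom // andbT.
  have [aC ax] := at_rankP x mC.
  by apply: contraNneq xC => e; rewrite -(ptrk_inj PL ax e).
apply: leq_sum => j _; rewrite at_rank_base //.
by have [->|mj] := eqVneq (m1 j) 0%N; rewrite ?mul0n // leq_mul2l dom ?orbT.
Qed.

Definition chains : {set {set 'I_n}} := [set C | max_chain C].
Local Notation r := #|chains|.
Definition chain_of (b : 'I_r) : {set 'I_n} := enum_val b.
Definition etab (b : 'I_r) : S := 'X_[dmon (chain_of b)].
Definition dgb (b : 'I_r) : nat := #|descents (chain_of b)|.

Lemma chain_ofP b : max_chain (chain_of b).
Proof. by have := enum_valP b; rewrite inE. Qed.

Lemma chain_of_surj C : max_chain C -> exists b, chain_of b = C.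
Proof.
move=> mC; have iC : C \in chains by rewrite inE.
by exists (enum_rank_in iC C); rewrite /chain_of enum_rankK_in.
Qed.

Definition spanned k (p : S) := exists t : 'I_r -> S,
  [/\ forall b, free_of nonbase (t b),
      forall b, t b != 0 -> (dgb b <= k)%N /\ t b \is (k - dgb b).-homog
    & I (p - \sum_b phi (t b) * etab b)].

Lemma spannedD k p q : spanned k p -> spanned k q -> spanned k (p + q).
Proof.
move=> [t [ft ht It]] [u [fu hu Iu]]; exists (fun b => t b + u b); split=> [b|b|].
- by apply: free_ofD; [apply: ft | apply: fu].
- have [->|tn] := eqVneq (t b) 0; first by rewrite add0r; apply: hu.
  have [->|un] := eqVneq (u b) 0; first by rewrite addr0; apply: ht.
  by move=> _; have [le h1] := ht b tn; have [_ h2] := hu b un; split; rewrite ?rpredD.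
rewrite (_ : _ - _ = (p - \sum_b phi (t b) * etab b) + (q - \sum_b phi (u b) * etab b)).
  exact: hibi_idealD.
rewrite addrACA -opprD -big_split; congr (_ - _); apply: eq_bigr => b _ /=.
by rewrite rmorphD mulrDl.
Qed.

Lemma spannedC k c p : spanned k p -> spanned k (c%:MP * p).
Proof.
move=> [t [ft ht It]]; exists (fun b => c%:MP * t b); split=> [b|b|].
- by apply: free_ofM; [apply: free_ofC | apply: ft].
- move=> nz; have tn : t b != 0 by apply: contraNneq nz => ->; rewrite mulr0.
  by have [le h] := ht b tn; split=> //; rewrite mul_mpolyC rpredZ.
rewrite (_ : _ - _ = c%:MP * (p - \sum_b phi (t b) * etab b)).
  exact: hibi_idealM.
rewrite mulrBr mulr_sumr; congr (_ - _); apply: eq_bigr => b _.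
by rewrite rmorphM /= substC mulrA.
Qed.

Lemma spanned0 k : spanned k 0.
Proof.
exists (fun=> 0); split=> [b|b|]; [exact: free_of0 | by rewrite eqxx |].
rewrite big1 ?subr0; first exact: hibi_ideal0.
by move=> b _; rewrite rmorph0 mul0r.
Qed.

Lemma spanned_mod k p q : I (p - q) -> spanned k q -> spanned k p.
Proof.
move=> Ipq [t [ft ht It]]; exists t; split=> //.
rewrite (_ : _ - _ = (p - q) + (q - \sum_b phi (t b) * etab b)).
  exact: hibi_idealD.
by rewrite addrA subrK.
Qed.

Lemma spanned_msupp k p : (forall m, m \in msupp p -> spanned k 'X_[m]) -> spanned k p.
Proof.
move=> sp; rewrite [p]mpolyE big_seq; apply: (big_ind (spanned k)).
- exact: spanned0.
- exact: spannedD.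
by move=> m mp; rewrite -mul_mpolyC; apply/spannedC/sp.
Qed.

Lemma base_free t : push base t = t -> free_of nonbase ('X_[t] : S).
Proof.
move=> bt m; rewrite msuppX inE => /eqP -> i; rewrite inE => bi.
rewrite -bt pushE big1 // => j _.
by case: eqP => // bj; rewrite -bj baseK eqxx in bi.
Qed.

Lemma spanned_phi_eta C t : max_chain C -> push base t = t ->
  spanned (mdeg (lead C t)) (phi 'X_[t] * 'X_[dmon C]).
Proof.
move=> mC bt; have [b bC] := chain_of_surj mC.
exists (fun b' => if b' == b then 'X_[t] else 0); split=> [b'|b'|].
- by case: eqP => _; [apply: base_free | apply: free_of0].
- have [->|_] := eqVneq b' b; last by rewrite eqxx.
  move=> _; rewrite /dgb bC /lead mdegD mdeg_push mdeg_dmon leq_addl addnK.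
  by rewrite dhomogX.
rewrite (bigD1 b) //= eqxx big1 => [|b' /negPf ->]; last by rewrite rmorph0 mul0r.
by rewrite addr0 /etab bC subrr; apply: hibi_ideal0.
Qed.

(* Induction on the lexicographic pair ([mQ], [mY]), which increases under
   straightening and from [lead C t] to the other standard monomials of
   [theta ^ t * eta_C], and is bounded in each degree. *)
Lemma spanned_monomial k m : mdeg m = k -> spanned k 'X_[m].
Proof.
pose QB := (k * \sum_i (ptrk i * ptrk i))%N; pose YB := (k * \sum_i (pt i).2)%N.
have Qle m' : mdeg m' = k -> (mQ m' <= QB)%N by rewrite /QB => <-; apply: msum_bound.
have Yle m' : mdeg m' = k -> (mY m' <= YB)%N by rewrite /YB => <-; apply: msum_bound.
have [q] := ubnP (QB - mQ m)%N; elim: q m => // q IHq m mq mk.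
have nonstd m' : mdeg m' = k -> (QB - mQ m' < q.+1)%N -> ~~ standard m' ->
    spanned k 'X_[m'].
  move=> mk' mq' /(straighten K PL)[m'' [_ dm Qm Im]].
  apply: (spanned_mod Im); apply: IHq; rewrite ?dm //.
  have := Qle m''; rewrite dm => /(_ mk'); lia.
have [y] := ubnP (YB - mY m)%N; elim: y m mq mk => // y IHy m mq mk my.
have [sm|nsm] := boolP (standard m); last exact: nonstd.
have [C mC /andP[dC mC']] := chain_between PL sm.
have [t [bt mE]] := standard_lead mC dC mC'.
have [z [zE zP]] := phi_eta_expand mC bt.
have -> : 'X_[m] = phi 'X_[t] * 'X_[dmon C] + (-1)%:MP * z.
  by rewrite zE mE mpolyCN mpolyC1 mulN1r addrK.
apply: spannedD; first by rewrite -mk mE; apply: spanned_phi_eta.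
apply/spannedC/spanned_msupp => m' /zP[Qm' dm' Ym'].
have mk' : mdeg m' = k by rewrite dm' -mE.
have mq' : (QB - mQ m' < q.+1)%N by rewrite Qm' -mE.
have [sm'|] := boolP (standard m'); last exact: nonstd.
apply: IHy => //; have := Yle _ mk'; have := Ym' sm'; rewrite -mE.
by move: my; lia.
Qed.

Lemma spanned_homog k p : p \is k.-homog -> spanned k p.
Proof.
by move=> /dhomogP hp; apply: spanned_msupp => m /hp mk; apply: spanned_monomial.
Qed.

Definition key_lt m m' := (mQ m < mQ m')%N || ((mQ m == mQ m') && (mY m < mY m')%N).

Lemma toric_coeff m (p : S) M : standard M ->
  (forall m', m' \in msupp p -> wt m' = wt M -> m' = M) ->
  (toric p)@_(wt M) = p@_M.
Proof.
move=> sM pM; rewrite {1}(mpolyE p) rmorph_sum raddf_sum /=.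
have e m' : m' \in msupp p -> (toric (p@_m' *: 'X_[m']))@_(wt M) = p@_m' * (m' == M)%:R.
  move=> mp; rewrite -mul_mpolyC rmorphM /= toricX.
  rewrite {1}/toric mmapC mul_mpolyC mcoeffZ mcoeffX; congr (_ * (nat_of_bool _)%:R).
  by apply/eqP/eqP => [/(pM _ mp)|->].
rewrite (eq_big_seq _ e) -[RHS]/(mcoeff M p) {3}(mpolyE p) raddf_sum /=.
by apply: eq_bigr => m' _; rewrite mcoeffZ mcoeffX.
Qed.

(** All monomials of the product share one [mQ], here at least that of [M], whereas by
    [standard_max] any other monomial of the weight of [M] has a smaller one. And [M] is not in [z],
    whose standard monomials exceed [lead C t] in [mY]. *)
Lemma toric_lead C0 t0 C t : max_chain C0 -> push base t0 = t0 ->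
  max_chain C -> push base t = t -> ~~ key_lt (lead C t) (lead C0 t0) ->
  (toric (phi 'X_[t] * 'X_[dmon C] : S))@_(wt (lead C0 t0)) =
  ((C == C0) && (t == t0))%:R.
Proof.
move=> mC0 bt0 mC bt nlt; set M := lead C0 t0.
have [z [-> zP]] := phi_eta_expand mC bt.
have sM := lead_standard t0 mC0; rewrite -/M in sM.
have Qle m' : mQ m' = mQ (lead C t) -> wt m' = wt M -> m' = M /\ mQ (lead C t) = mQ M.
  move=> Qm' wm'; move: nlt; rewrite /key_lt -/M negb_or -leqNgt => /andP[le _].
  have [e|] := standard_max K PL sM wm'; first by rewrite -Qm' e.
  by rewrite Qm' ltnNge le.
have zM : M \notin msupp z.
  apply/negP => /zP[Qm' _ /(_ sM) Ym']; move: nlt; rewrite /key_lt -/M Qm' eqxx.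
  by rewrite Ym' orbT.
rewrite toric_coeff //.
- rewrite mcoeffD (memN_msupp_eq0 zM) addr0 mcoeffX; congr (nat_of_bool _)%:R.
  apply/eqP/andP => [e|[/eqP -> /eqP ->]] //.
  by have [-> ->] := lead_inj mC mC0 bt bt0 e.
move=> m' /msuppD_le; rewrite mem_cat => /orP[].
  by rewrite msuppX inE => /eqP -> /(Qle _ erefl)[].
by move=> /zP[Qm' _ _] /(Qle _ Qm')[].
Qed.

Lemma free_base (p : S) m : free_of nonbase p -> m \in msupp p -> push base m = m.
Proof.
move=> fp mp; apply: push_id => j mj; apply/eqP; apply: contraNT mj => bj.
by rewrite (fp _ mp) // inE.
Qed.

(** Induction on the key of the leading monomial: once coefficients of smaller key vanish, the toric
    image read at the weight of [M] retains only the coefficient of [m] in [t b]. *)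
Lemma etab_indep (t : 'I_r -> S) : (forall b, free_of nonbase (t b)) ->
  I (\sum_b phi (t b) * etab b) -> forall b, t b = 0.
Proof.
move=> ft /(toric_ideal PL) It b; apply/mpolyP => m; rewrite mcoeff0.
have [q] := ubnP (mQ (lead (chain_of b) m)).
elim: q b m => // q IHq b m; have [y] := ubnP (mY (lead (chain_of b) m)).
elim: y b m => // y IHy b m my mq.
have [mt|/memN_msupp_eq0 //] := boolP (m \in msupp (t b)).
have bm := free_base (ft b) mt; pose M := lead (chain_of b) m.
have := congr1 (mcoeff (wt M)) It; rewrite mcoeff0 rmorph_sum raddf_sum /=.
have e b' : (toric (phi (t b') * etab b'))@_(wt M) =
    \sum_(m' <- msupp (t b')) (t b')@_m' * ((chain_of b' == chain_of b) && (m' == m))%:R.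
  rewrite {1}(mpolyE (t b')) rmorph_sum mulr_suml rmorph_sum raddf_sum /=.
  apply: eq_big_seq => m' mt'; rewrite -mul_mpolyC (rmorphM (subst rank_sum)) /= substC -mulrA.
  rewrite (rmorphM (@toric K L)) /= {1}/toric mmapC mul_mpolyC mcoeffZ.
  have [lt|nlt] := boolP (key_lt (lead (chain_of b') m') M); last first.
    by rewrite /etab toric_lead //; [apply: chain_ofP| apply: chain_ofP|apply: free_base mt'].
  suff -> : (t b')@_m' = 0 by rewrite !mul0r.
  case/orP: lt => [ltQ|/andP[/eqP eQ ltY]].
    by apply: IHq; apply: leq_trans ltQ _; rewrite -ltnS.
  by apply: IHy; [apply: leq_trans ltY _; rewrite -ltnS | rewrite eQ].
rewrite (eq_bigr _ (fun b' _ => e b')) (bigD1 b) //= [X in _ + X]big1 ?addr0; last first.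
  move=> b' bb; rewrite big1 // => m' _.
  rewrite (inj_eq enum_val_inj); by rewrite (negPf bb) mulr0.
rewrite (bigD1_seq m) ?msupp_uniq //= !eqxx mulr1 big1 ?addr0 // => m' /negPf mm.
by rewrite mm andbF mulr0.
Qed.

Theorem hibi_reg : exists F : gfres K n,
  is_min_graded_free_res I F /\ reg_of_res F = (\max_b dgb b)%N.
Proof.
(* In the coordinates of [I'] the rank sums are variables, as the predicate [free_of nonbase]
   demands. *)
pose I' (p : S) := I (phi p).
(* A maximal chain without descents gives the basis element 1 of degree 0. *)
have [C0 mC0 dC0] : exists2 C : {set 'I_n}, max_chain C & descents C = set0.
  have c0 : is_chain (set0 : {set 'I_n}) by apply/is_chainP => i j; rewrite in_set0.
  have [C mC /andP[+ _]] := chain_between PL c0.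
  by rewrite subset0 => /eqP dC; exists C.
have [b0 b0C] := chain_of_surj mC0.
have phiK b : phi (subst rank_diff (etab b)) = etab b by apply: rank_sumK.
have sumE (t : 'I_r -> S) : phi (\sum_b t b * subst rank_diff (etab b)) =
    \sum_b phi (t b) * etab b.
  by rewrite rmorph_sum; apply: eq_bigr => b _; rewrite rmorphM /= phiK.
have [||||||||F [minF regF]] := @free_basis_resolution K n nonbase r
    (fun b => subst rank_diff (etab b)) dgb I' b0.
- by rewrite /I' rmorph0; apply: hibi_ideal0.
- by move=> p q; rewrite /I' rmorphD; apply: hibi_idealD.
- by move=> p q; rewrite /I' rmorphM; apply: hibi_idealM.
- move=> b; apply: subst_homog; first exact: rank_diff_homog.
  by rewrite dhomogX /= mdeg_dmon.
- move=> k p hp; have [|t [ft ht It]] := spanned_homog (p := phi p) (k := k).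
    by apply: subst_homog => //; apply: rank_sum_homog.
  by exists t; split=> //; rewrite /I' rmorphB /= sumE.
- by move=> t ft; rewrite /I' sumE; apply: etab_indep.
- rewrite /etab b0C (_ : dmon C0 = 0%MM) ?mpolyX0 ?rmorph1 //.
  by apply/mnmP => i; rewrite mnmE dC0 inE mnm0E.
- by rewrite /dgb b0C dC0 cards0.
exists (map_gfres (subst rank_sum) F); split; last by rewrite reg_map_gfres.
apply: (@map_gfres_min _ _ (subst rank_sum) (subst rank_diff)) minF.
- exact: rank_diffK.
- exact: rank_sumK.
by move=> d p; apply: subst_homog; apply: rank_sum_homog.
Qed.

End StandardBasis.

(** * Cyclic sublattices *)

Section CyclicSublattices.
Variable L : seq (nat * nat).
Hypothesis PL : planar_distr_lattice L.
Local Notation n := (size L).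
Local Notation pt := (pt (L := L)).
Local Notation ptrk := (ptrk (L := L)).

Lemma le2_trans a b c : le2 a b -> le2 b c -> le2 a c.
Proof. by rewrite /le2; lia. Qed.

(** The first step of a unit chain from [a] to [b] must already reach [b], as nothing lies strictly
    between. *)
Lemma covers_unit a b : covers L a b -> unit_step a b.
Proof.
case: PL => _ _ _ conn [aL bL /andP[ab leab] nob].
have [[|c s] [ps ls sL]] := conn a b aL bL leab.
  by rewrite -ls eqxx in ab.
move: ps sL => /= /andP[ac ps] /andP[cL sL].
have cb : le2 c b.
  move: ls; rewrite /= => <-; elim: s c ps {sL ac cL} => [|d s IH] c /=.
    by rewrite /le2 !leqnn.
  by case/andP=> /andP[/andP[_ cd] _] /IH; apply: le2_trans.
have [<- //|cnb] := eqVneq c b; case: (nob c cL); split.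
  by case/andP: ac.
by rewrite /lt2 cnb.
Qed.

Lemma unit_covers a b : a \in L -> b \in L -> unit_step a b -> covers L a b.
Proof.
move=> aL bL /andP[ab /eqP cb]; split=> // c _ []; move: ab cb.
rewrite /lt2 /le2 /csum; case: a b c {aL bL} => [a1 a2] [b1 b2] [c1 c2] /=.
rewrite !xpair_eqE; lia.
Qed.

Lemma square_corners a b c d : square L a b c d ->
  [/\ a \in L, (a.1, a.2.+1) \in L, (a.1.+1, a.2) \in L, (a.1.+1, a.2.+1) \in L
    & d = (a.1.+1, a.2.+1)].
Proof.
case=> -[ab bd] [ac cd] inc jd _.
have [aL bL _ _] := ab; have [_ dL _ _] := bd; have [_ cL _ _] := ac.
have [/covers_unit/andP[ab1 ab2] /covers_unit/andP[ac1 ac2]] := (ab, ac).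
have bc : (b = (a.1, a.2.+1) /\ c = (a.1.+1, a.2)) \/
          (c = (a.1, a.2.+1) /\ b = (a.1.+1, a.2)).
  move: ab1 ab2 ac1 ac2 inc; rewrite /lt2 /le2 /csum /incomp2 /le2.
  case: a b c {ab bd ac cd jd aL bL dL cL} => [a1 a2] [b1 b2] [c1 c2] /=.
  rewrite !xpair_eqE => h1 h2 h3 h4 h5.
  have [e|e] : b1 = a1 \/ b1 = a1.+1 by lia.
    by left; split; congr (_, _); lia.
  by right; split; congr (_, _); lia.
have dE : d = (a.1.+1, a.2.+1).
  by rewrite -jd; case: bc => -[-> ->]; rewrite /join2 /=; congr (_, _); lia.
by rewrite -dE; case: bc => -[<- <-].
Qed.

Lemma prop_path_le P x s : (forall u v, P u v -> le2 u v) ->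
  prop_path P x s -> le2 x (last x s).
Proof.
move=> Ple Ps; rewrite (last_nth x).
suff h k : (k <= size s)%N -> le2 x (nth x (x :: s) k) by apply: h.
elim: k => [|k IH] ks; first by rewrite /le2 !leqnn.
by apply: le2_trans (IH (ltnW ks)) _; apply: Ple; apply: Ps.
Qed.

(** Bottoms, upper left corners and tops of the squares form a chain. In any maximal chain
    containing it each upper left corner is a descent, because the lower right corner of its square
    is in [L]. *)
Lemma cyclic_chain m : cyclic_sublattice L m ->
  exists2 C : {set 'I_n}, max_chain C & (m <= #|descents C|)%N.
Proof.
case=> Q [ch [sqQ link _ _]]; pose a i := sq_a (Q i).
pose d i := ((a i).1.+1, (a i).2.+1).
have sq i : (i < m)%N -> [/\ a i \in L, ((a i).1, (a i).2.+1) \in L,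
    ((a i).1.+1, (a i).2) \in L, d i \in L & sq_d (Q i) = d i].
  by move=> /sqQ/square_corners.
have da1 i : (i.+1 < m)%N -> le2 (d i) (a i.+1).
  move=> im; have [_ _ _ _ <-] := sq i (ltnW im); have [ls pp _] := link i im.
  by rewrite /a -ls; apply: prop_path_le pp => u v [[_ _ /andP[_ ]]].
have da i j : (i < j < m)%N -> le2 (d i) (a j).
  elim: j => // j IH /andP[ij jm]; have := da1 j jm.
  have [->//|ij'] := eqVneq i j.
  apply: le2_trans; have /IH : (i < j < m)%N by lia.
  by move=> h; apply: le2_trans h _; rewrite /d /le2 /=; lia.
(* Indices of the bottom, upper left, lower right and top corners of the squares. *)
have [fa faE] := fin_all_exists (fun i : 'I_m => ptP (let: And5 h _ _ _ _ := sq i (ltn_ord i) in h)).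
have [fu fuE] := fin_all_exists (fun i : 'I_m => ptP (let: And5 _ h _ _ _ := sq i (ltn_ord i) in h)).
have [fr frE] := fin_all_exists (fun i : 'I_m => ptP (let: And5 _ _ h _ _ := sq i (ltn_ord i) in h)).
have [fd fdE] := fin_all_exists (fun i : 'I_m => ptP (let: And5 _ _ _ h _ := sq i (ltn_ord i) in h)).
pose D : {set 'I_n} := [set x | [exists i, [|| x == fa i, x == fu i | x == fd i]]].
have DP x : x \in D -> exists i : 'I_m, [/\ le2 (a i) (pt x), le2 (pt x) (d i) &
    pt x = a i \/ pt x = ((a i).1, (a i).2.+1) \/ pt x = d i].
  rewrite inE => /existsP[i /or3P[]/eqP->]; exists i;
  rewrite ?faE ?fuE ?fdE /d /le2 /=; split; auto; lia.
have cD : is_chain D.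
  apply/is_chainP => x y /DP[i [ax xd xE]] /DP[j [ay yd yE]]; rewrite /cmp.
  have [ij|ji|ij] := ltngtP i j.
  - have h : le2 (d i) (a j) by apply: da; rewrite ij /=.
    by rewrite (le2_trans xd (le2_trans h ay)).
  - have h : le2 (d j) (a i) by apply: da; rewrite ji /=.
    by rewrite (le2_trans yd (le2_trans h ax)) orbT.
  move: xE yE; rewrite ij /d => xE yE.
  by case: xE => [|[|]] ->; case: yE => [|[|]] ->; rewrite /le2 /=; lia.
have [C mC /subsetP DC] := extend_chain PL cD; exists C => //.
have inC i : [/\ fa i \in C, fu i \in C & fd i \in C].
  by split; apply: DC; rewrite inE; apply/existsP; exists i; rewrite eqxx ?orbT.
have fu_desc i : fu i \in descents C.
  apply/descentP; exists (fa i), (fd i), (fr i); have [h1 h2 h3] := inC i.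
  by rewrite /corner h1 h2 h3 /stepN /stepE faE fuE frE fdE /d !eqxx.
have fu_inj : injective fu.
  move=> i j e; have := fuE i; rewrite e fuE => eu; apply: val_inj.
  have [ij|ji|//] := ltngtP i j.
    have := da i j; rewrite ij ltn_ord => /(_ isT); move: eu; rewrite /d /le2 /=.
    by move=> []; lia.
  have := da j i; rewrite ji ltn_ord => /(_ isT); move: eu; rewrite /d /le2 /=.
  by move=> []; lia.
rewrite -[m]card_ord -(card_imset _ fu_inj); apply: subset_leq_card.
by apply/subsetP => x /imsetP[i _ ->].
Qed.

(** * The cyclic sublattice cut out by the descents of a maximal chain *)

Section FromChain.
Variable C : {set 'I_n}.
Hypothesis mC : max_chain C.

Definition top_rank := (\max_i ptrk i)%N.
(** The default [(0, 0)] is met only above [top_rank]. *)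
Definition cpt (k : nat) : nat * nat :=
  if [pick j in C | ptrk j == k] is Some j then pt j else (0, 0)%N.

Lemma cptP k : (k <= top_rank)%N -> exists j, [/\ j \in C, ptrk j = k & cpt k = pt j].
Proof.
move=> kt; have [i ki] : exists i, (k <= ptrk i)%N.
  have [o _] := pt_origin PL.
  have [i iE] : {i | \max_i ptrk i = ptrk i}%N.
    by apply: eq_bigmax; rewrite card_ord (leq_ltn_trans _ (ltn_ord o)).
  by exists i; rewrite -iE.
have [w wk] := rank_ex PL ki; have [j jC jw] := max_chain_hit w mC.
rewrite /cpt; case: pickP => [j' /andP[j'C /eqP j'k]|none]; first by exists j'.
by have := none j; rewrite jC jw wk eqxx.
Qed.

Lemma cpt_rk j : j \in C -> cpt (ptrk j) = pt j.
Proof.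
move=> jC; have jt : (ptrk j <= top_rank)%N by exact: leq_bigmax.
by have [j' [j'C /(max_chain_uniq PL mC j'C jC) -> ->]] := cptP jt.
Qed.

Lemma cpt_in k : (k <= top_rank)%N -> cpt k \in L.
Proof. by case/cptP => j [_ _ ->]; apply: pt_in. Qed.

Lemma csum_cpt k : (k <= top_rank)%N -> csum (cpt k) = k.
Proof. by case/cptP => j [_ jk ->]. Qed.

Lemma cpt_le k l : (k <= l <= top_rank)%N -> le2 (cpt k) (cpt l).
Proof.
case/andP=> kl lt; have [j [jC jk ->]] := cptP (leq_trans kl lt).
have [i [iC il ->]] := cptP lt.
by apply: cmp_le; [apply: (max_chain_cmp mC) | rewrite jk il].
Qed.

Lemma cpt_unit k : (k < top_rank)%N -> unit_step (cpt k) (cpt k.+1).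
Proof.
move=> kt; have kt' := ltnW kt; rewrite /unit_step /lt2 !csum_cpt // eqxx andbT.
rewrite cpt_le ?leqnSn // andbT; apply: contraTneq (ltnSn k) => e.
by rewrite -{1}(csum_cpt kt') e csum_cpt // ltnn.
Qed.

Lemma cpt_covers k : (k < top_rank)%N -> covers L (cpt k) (cpt k.+1).
Proof.
by move=> kt; apply: unit_covers; rewrite ?cpt_in ?cpt_unit // ltnW.
Qed.

(** At a descent of rank [k] this is the lower right corner of its square. *)
Definition flip (k : nat) : nat * nat := ((cpt k).1.+1, (cpt k.-1).2).

Definition is_desc (k : nat) := [&& (0 < k)%N, (k < top_rank)%N,
  cpt k == ((cpt k.-1).1, (cpt k.-1).2.+1),
  cpt k.+1 == ((cpt k).1.+1, (cpt k).2) & flip k \in L].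

Definition desc_ranks := [seq k <- iota 0 top_rank | is_desc k].

Lemma mem_desc_ranks k : (k \in desc_ranks) = is_desc k.
Proof.
rewrite mem_filter mem_iota /= add0n andbC; case: (ltnP k top_rank) => //= kt.
by apply/esym/negP => /and3P[_]; rewrite ltnNge kt.
Qed.

Lemma size_desc_ranks : size desc_ranks = #|descents C|.
Proof.
rewrite cardE -(size_map ptrk); apply: perm_size; apply: uniq_perm.
- by rewrite filter_uniq ?iota_uniq.
- rewrite map_inj_in_uniq ?enum_uniq // => x y; rewrite !mem_enum => xD yD.
  by apply: (max_chain_uniq PL mC); apply: (subsetP (descents_sub C)).
move=> k; rewrite mem_desc_ranks; apply/idP/mapP => [|[x]].
  case/and5P=> k0 kt /eqP kN /eqP kE fL.
  have kp : (k.-1 <= top_rank)%N by lia.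
  have [p [pC pk pE]] := cptP kp; have [q [qC qk qE]] := cptP kt.
  have [x [xC xk xE]] := cptP (ltnW kt).
  have [z zE] := ptP fL; exists x => //; rewrite mem_enum.
  apply/descentP; exists p, q, z.
  by rewrite /corner pC xC qC /stepN /stepE -pE -qE -xE zE /flip kE kN !eqxx.
rewrite mem_enum => /descentP[p [q [z /and5P[pC xC qC /eqP px /andP[/eqP xq /eqP pz]]]]] ->.
have rx : ptrk x = (ptrk p).+1 by rewrite /ptrk /csum px /=; lia.
have rq : ptrk q = (ptrk x).+1 by rewrite /ptrk /csum xq /=; lia.
rewrite /is_desc /flip -rq !cpt_rk // rx /= cpt_rk //.
rewrite xq px !eqxx /= -pz pt_in andbT; exact: leq_bigmax.
Qed.

Local Notation drk := (nth 0%N desc_ranks).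
Local Notation m := (size desc_ranks).

Lemma drk_desc i : (i < m)%N -> is_desc (drk i).
Proof. by move=> im; rewrite -mem_desc_ranks mem_nth. Qed.

Lemma drk_lt i j : (i < j < m)%N -> (drk i < drk j)%N.
Proof.
case/andP=> ij jm; apply: (sorted_ltn_nth ltn_trans) => //.
  by apply: sorted_filter ltn_trans _ _ (iota_ltn_sorted _ _).
by rewrite inE (ltn_trans ij).
Qed.

(** A descent is left by an east step, but the next one would have to be entered by a north step.
    Hence successive squares meet at most in a top equal to a bottom. *)
Lemma desc_succ k : is_desc k -> ~~ is_desc k.+1.
Proof.
case/and5P=> _ _ _ /eqP e _; rewrite /is_desc e /=.
by rewrite xpair_eqE /=; apply/negP; lia.
Qed.

Lemma drk_gap i : (i.+1 < m)%N -> ((drk i).+1 < drk i.+1)%N.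
Proof.
move=> im; have lt : (drk i < drk i.+1)%N by apply: drk_lt; rewrite leqnn.
rewrite ltn_neqAle lt andbT; apply/eqP => e.
have := desc_succ (drk_desc (ltnW im)); rewrite e.
by rewrite drk_desc.
Qed.

Definition dsquare i := let k := drk i in Sq (cpt k.-1) (cpt k) (flip k) (cpt k.+1).
(** The top of square [i] has rank [(drk i).+1] and the bottom of the next square has rank
    [(drk i.+1).-1]: the list starts just above the former, ends at the latter, and is empty when
    they coincide. *)
Definition dlink i := [seq cpt k | k <- iota (drk i).+2 (drk i.+1 - (drk i).+2)].

Lemma dsquareP i : (i < m)%N -> let k := drk i in let a := cpt k.-1 in
  [/\ (0 < k < top_rank)%N, cpt k = (a.1, a.2.+1), flip k = (a.1.+1, a.2),
      cpt k.+1 = (a.1.+1, a.2.+1) & flip k \in L].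
Proof.
move=> /drk_desc/and5P[k0 kt /eqP kN /eqP kE fL] /=.
by split; rewrite ?k0 // ?kE /flip kN.
Qed.

Let elems := flatten [seq sq_elems (dsquare i) | i <- iota 0 m] ++
  flatten [seq dlink i | i <- iota 0 m.-1].

Lemma elems_square i x : (i < m)%N -> x \in sq_elems (dsquare i) -> x \in elems.
Proof.
move=> im xi; rewrite mem_cat; apply/orP; left; apply/flattenP.
by exists (sq_elems (dsquare i)) => //; apply/map_f; rewrite mem_iota.
Qed.

Lemma elems_link i x : (i.+1 < m)%N -> x \in dlink i -> x \in elems.
Proof.
move=> im xi; rewrite mem_cat; apply/orP; right; apply/flattenP.
by exists (dlink i) => //; apply/map_f; rewrite mem_iota /=; lia.
Qed.

Lemma drk_bounds i : (i < m)%N -> (0 < drk i < top_rank)%N.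
Proof. by case/dsquareP. Qed.

Lemma elemsP x : x \in elems ->
  (exists2 k, (k <= top_rank)%N & x = cpt k) \/
  (exists2 i, (i < m)%N & x = flip (drk i)).
Proof.
rewrite mem_cat => /orP[] /flattenP[s /mapP[i]]; rewrite mem_iota /= add0n => im -> {s}.
  have /andP[k0 kt] := drk_bounds im.
  rewrite !inE => /or4P[]/eqP ->; [left|left|right|left].
  - by exists (drk i).-1 => //; lia.
  - by exists (drk i) => //; lia.
  - by exists i.
  by exists (drk i).+1.
have im1 : (i.+1 < m)%N by lia.
have /andP[k0 kt] := drk_bounds im1; case/mapP=> k; rewrite mem_iota => kk ->.
by left; exists k => //; lia.
Qed.

Lemma csum_flip i : (i < m)%N -> csum (flip (drk i)) = drk i.
Proof.
move=> im; have [/andP[k0 kt] kN kF _ _] := dsquareP im.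
have := csum_cpt (ltnW kt); rewrite kN kF /csum /=; lia.
Qed.

(** [C] has one element per rank and [flip] adds a second one at descent ranks only. *)
Lemma only_cpt k : (k <= top_rank)%N -> (forall j, (j < m)%N -> drk j <> k) ->
  only_of_its_rank elems (cpt k).
Proof.
move=> kt kj x /elemsP[[l lt ->]|[i im ->]]; rewrite /rank2 (csum_cpt kt).
  by rewrite csum_cpt // => ->.
by rewrite csum_flip // => /(kj i im).
Qed.

Lemma flip_le_cpt i k : (i < m)%N -> (k <= top_rank)%N -> k <> drk i ->
  le2 (cpt k) (flip (drk i)) || le2 (flip (drk i)) (cpt k).
Proof.
move=> im kt ki; have [/andP[k0 kt'] kN kF kE _] := dsquareP im.
have [lt|gt|//] := ltngtP k (drk i); apply/orP; [left|right].
  have h : le2 (cpt k) (cpt (drk i).-1) by apply: cpt_le; lia.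
  by apply: le2_trans h _; rewrite kF /le2 /=; lia.
have h : le2 (cpt (drk i).+1) (cpt k) by apply: cpt_le; rewrite gt.
by apply: le2_trans h; rewrite kF kE /le2 /=; lia.
Qed.

Lemma flip_le_flip i j : (i < j < m)%N -> le2 (flip (drk i)) (flip (drk j)).
Proof.
case/andP=> ij jm; have im := ltn_trans ij jm.
have [/andP[k0 kt] kN kF kE _] := dsquareP im.
have [/andP[l0 lt] lN lF lE _] := dsquareP jm.
have gap : ((drk i).+1 <= (drk j).-1)%N.
  have g := drk_gap (leq_ltn_trans ij jm).
  have [e|ne] := eqVneq i.+1 j; first by rewrite -e; lia.
  have : (drk i.+1 < drk j)%N by apply: drk_lt; lia.
  lia.
have h : le2 (cpt (drk i).+1) (cpt (drk j).-1) by apply: cpt_le; lia.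
apply: (@le2_trans _ (cpt (drk i).+1)); first by rewrite kF kE /le2 /=; lia.
by apply: le2_trans h _; rewrite lF /le2 /=; lia.
Qed.

(** The only incomparable pairs are the two middle corners of a square, whose join and meet are its
    top and bottom. *)
Lemma elems_sublattice : sublattice2 elems.
Proof.
have comp x y : x \in elems -> y \in elems -> le2 x y || le2 y x ->
    (join2 x y \in elems) /\ (meet2 x y \in elems).
  move=> xe ye /orP[]; rewrite /le2 => /andP[l1 l2]; split.
  - by rewrite (_ : join2 x y = y) // /join2 (maxn_idPr l1) (maxn_idPr l2); case: (y).
  - by rewrite (_ : meet2 x y = x) // /meet2 (minn_idPl l1) (minn_idPl l2); case: (x).
  - by rewrite (_ : join2 x y = x) // /join2 (maxn_idPl l1) (maxn_idPl l2); case: (x).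
  - by rewrite (_ : meet2 x y = y) // /meet2 (minn_idPr l1) (minn_idPr l2); case: (y).
have jC x y : join2 x y = join2 y x by rewrite /join2 maxnC [X in (_, X)]maxnC.
have mCm x y : meet2 x y = meet2 y x by rewrite /meet2 minnC [X in (_, X)]minnC.
have mixed i k : (i < m)%N -> (k <= top_rank)%N ->
    cpt k \in elems -> flip (drk i) \in elems ->
    (join2 (cpt k) (flip (drk i)) \in elems) /\ (meet2 (cpt k) (flip (drk i)) \in elems).
  move=> im kt xe ye; have [->|/eqP ki] := eqVneq k (drk i); last first.
    by apply: comp => //; apply: flip_le_cpt.
  have [_ kN kF kE _] := dsquareP im.
  have -> : join2 (cpt (drk i)) (flip (drk i)) = cpt (drk i).+1.
    by rewrite kN kF kE /join2 /=; congr (_, _); lia.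
  have -> : meet2 (cpt (drk i)) (flip (drk i)) = cpt (drk i).-1.
    by rewrite kN kF /meet2 /=; case: (cpt _) => a b /=; congr (_, _); lia.
  by split; apply: (elems_square im); rewrite !inE eqxx ?orbT.
move=> x y xe ye; have [[k kt xk]|[i im xi]] := elemsP xe;
  have [[l lt yl]|[j jm yj]] := elemsP ye.
- apply: comp => //; rewrite xk yl.
  by case: (leqP k l) => kl; apply/orP; [left|right]; apply: cpt_le; lia.
- by rewrite xk yj; apply: mixed; rewrite -?xk -?yj.
- by rewrite jC mCm xi yl; apply: mixed; rewrite -?xi -?yl.
apply: comp => //; rewrite xi yj.
have [ij|ji|->] := ltngtP i j; last by rewrite /le2 !leqnn.
  by rewrite flip_le_flip // ij.
by rewrite orbC flip_le_flip // ji.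
Qed.

Lemma chain_cyclic : cyclic_sublattice L #|descents C|.
Proof.
rewrite -size_desc_ranks; exists dsquare, dlink; rewrite -/elems; split.
- move=> i im; have [/andP[k0 kt] kN kF kE fL] := dsquareP im.
  have kp : (drk i).-1.+1 = drk i by rewrite prednK.
  have aL : cpt (drk i).-1 \in L by apply: cpt_in; lia.
  have dL : cpt (drk i).+1 \in L by apply: cpt_in.
  rewrite /dsquare /=; split.
  + split; last exact: cpt_covers.
    by rewrite -{2}kp; apply: cpt_covers; lia.
  + split; apply: unit_covers => //; rewrite kF ?kE /unit_step /lt2 /le2 /csum;
      case: (cpt _) => a b /=; rewrite xpair_eqE; lia.
  + by rewrite kN kF /incomp2 /le2 /=; lia.
  + by rewrite kN kF kE /join2 /=; congr (_, _); lia.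
  by rewrite kN kF /meet2 /=; case: (cpt _) => a b /=; congr (_, _); lia.
- move=> i im; have im' := ltnW im; have gap := drk_gap im.
  have /andP[k0 kt] := drk_bounds im'; have /andP[l0 lt] := drk_bounds im.
  have consE : cpt (drk i).+1 :: dlink i =
      [seq cpt k | k <- iota (drk i).+1 (drk i.+1 - (drk i).+1)].
    by rewrite /dlink -[in RHS](subnSK gap).
  have sz : size (dlink i) = (drk i.+1 - (drk i).+2)%N by rewrite size_map size_iota.
  have nthE k : (k <= size (dlink i))%N ->
      nth (cpt (drk i).+1) (cpt (drk i).+1 :: dlink i) k = cpt ((drk i).+1 + k).
    rewrite sz => kl; rewrite consE (nth_map 0%N) ?size_iota; last by lia.
    by rewrite nth_iota //; lia.
  rewrite /dsquare /=; split.
  + rewrite (last_nth (cpt (drk i).+1)) nthE // sz; congr cpt; lia.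
  + move=> k kl; rewrite !nthE //; last exact: ltnW.
    have kl' := kl; rewrite sz in kl'; rewrite addnS.
    (* No descent rank lies strictly between two successive ones, so both ends of a link edge are
       alone in their rank and the edge is a cut edge. *)
    have nod l : ((drk i).+1 <= l < drk i.+1)%N -> forall j, (j < m)%N -> drk j <> l.
      move=> lb j jm; have [ji|ij] := leqP j i.
        have [->|ne] := eqVneq j i; first by lia.
        have : (drk j < drk i)%N by apply: drk_lt; lia.
        by lia.
      have [->|ne] := eqVneq j i.+1; first by lia.
      have : (drk i.+1 < drk j)%N by apply: drk_lt; lia.
      by lia.
    have inE' l : (l <= size (dlink i))%N -> cpt ((drk i).+1 + l) \in elems.
      move=> ll; rewrite -nthE //; case: l ll => [_|l ll] /=.
        by apply: (elems_square im'); rewrite !inE eqxx ?orbT.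
      by apply: (elems_link im); rewrite mem_nth.
    split; first by apply: cpt_covers; lia.
    split.
    * by apply: inE'; apply: ltnW.
    * by have := inE' _ kl; rewrite addnS.
    * by rewrite /rank2 !csum_cpt //; lia.
    * by apply: only_cpt; [lia | apply: nod; lia].
    by apply: only_cpt; [lia | apply: nod; lia].
  by apply/allP => x /mapP[k]; rewrite mem_iota => kk ->; apply: cpt_in; lia.
- apply/allP => x /elemsP[[k kt ->]|[i im ->]]; first exact: cpt_in.
  by have [] := dsquareP im.
exact: elems_sublattice.
Qed.

End FromChain.
End CyclicSublattices.

Theorem theorem4 (K : fieldType) (L : seq (nat * nat)) :
  planar_distr_lattice L -> simple_lattice L ->
  exists m : nat, max_cyclic_squares L m /\ reg_is (in_hibi_ideal (K:=K) (L:=L)) m.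
Proof.
move=> PL _; exists (\max_b dgb (L := L) b)%N; split; last exact: hibi_reg.
split=> [|m' /(cyclic_chain PL)[C mC le]]; last first.
  have [b bC] := chain_of_surj mC.
  by apply: leq_trans le _; rewrite -bC; apply: (leq_bigmax b).
(* Some maximal chain exists, so the maximum is attained. *)
have [C0 mC0 _] : exists2 C : {set 'I_(size L)}, max_chain C & set0 \subset C.
  by apply: extend_chain => //; apply/is_chainP => i j; rewrite in_set0.
have [b0 _] := chain_of_surj mC0.
have [|b ->] := eq_bigmax (dgb (L := L)); last exact: chain_cyclic (chain_ofP b).
by rewrite card_ord (leq_ltn_trans _ (ltn_ord b0)).
Qed.
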